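(* Let $(A,t,\mu,\eta,s,\psi,\zeta,\sigma)$ be a wreath in a 2-category $\mathcal{K}$, and put $\mathbb{A}=(A,t,\mu,\eta)$. Then the following assertions are equivalent: (i) $(A,t,\mu,\eta,s,\psi,\zeta,\sigma)$ is a Frobenius monad in $EM(\mathcal{K})$, that is, a Frobenius wreath in $\mathcal{K}$. (ii) $(s,\psi)$ is a Frobenius algebra in the monoidal category $EM(\mathcal{K})(\mathbb{A})$. (iii) $(s,\psi)$ admits a coalgebra structure in $EM(\mathcal{K})(\mathbb{A})$ whose comultiplication is $(s,\psi)$-bilinear; that is, there is a cowreath structure in $\mathcal{K}$ of the form $(\mathbb{A},s,\psi,\delta:s\Rightarrow sst,\varepsilon:s\Rightarrow t)$ such that $$(1_s\odot1_s\odot\mu)(\delta\odot1_t)\zeta=(1_s\odot1_s\odot\mu)(1_s\odot\zeta\odot1_t)(1_s\odot1_s\odot\psi)(\delta\odot1_s)=(1_s\odot1_s\odot\mu)(1_s\odot\psi\odot1_t)(\zeta\odot1_s\odot1_t)(1_s\odot\delta).$$ (iv) There exists an adjunction $(\rho,\lambda):(s,\psi)\dashv(s,\psi)$ in $EM(\mathcal{K})(\mathbb{A})$ such that $\lambda$ is associative, i.e. $\mu(\lambda\odot1_t)(1_s\odot\psi)(\zeta\odot1_s)=\mu(\lambda\odot1_t)(1_s\odot\zeta)$. (v) There is an adjunction $(\rho,\lambda):(s,\psi)\dashv(s,\psi)$ in $EM(\mathcal{K})(\mathbb{A})$ with $\lambda$ of the form $\lambda=\mu(\vartheta\odot1_t)\zeta:ss\Rightarrow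 t$ for some 2-cell $\vartheta:s\Rightarrow t$ in $\mathcal{K}$. If $\mathcal{K}(A)$ admits coequalizers and every object of it is coflat, then (i)–(v) are also equivalent to (vi) The canonical monad extension associated to $(A,t,\mu,\eta,s,\psi,\zeta,\sigma)$ is Frobenius.
   Context: In a 2-category $\mathcal{K}$, vertical composition of 2-cells is written by juxtaposition, horizontal composition by $\odot$, composition of 1-cells by juxtaposition; $1_f$ is the identity 2-cell of a 1-cell $f$. For a 0-cell $U$, $\mathcal{K}(U)=\mathcal{K}(U,U)$ is a monoidal category with tensor product given by horizontal composition and unit object the identity 1-cell $1_U$. A monad $(A,t,\mu,\eta)$ in $\mathcal{K}$ is a 1-cell $t:A\to A$ with 2-cells $\mu:tt\Rightarrow t$, $\eta:1_A\Rightarrow t$ satisfying associativity and unit axioms, i.e. an algebra in $\mathcal{K}(A)$. It is Frobenius if there are 2-cells $\vartheta:t\Rightarrow1_A$, $e:1_A\Rightarrow tt$ with $(\mu\odot1_t)(1_t\odot e)=(1_t\odot\mu)(e\odot1_t)$ and $(\vartheta\odot1_t)e=\eta=(1_t\odot\vartheta)e$. The 2-category $EM(\mathcal{K})$: 0-cells are monads in $\mathcal{K}$; a 1-cell $(A,t,\mu_t,\eta_t)\to(B,r,\mu_r,\eta_r)$ is a pair $(f,\psi)$, $f:A\to B$ a 1-cell and $\psi:rf\Rightarrow ft$ a 2-cell, with $(1_f\odot\mu_t)(\psi\odot1_t)(1_r\odot\psi)=\psi(\mu_r\odot1_f)$ and $\psi(\eta_r\odot1_f)=1_f\odot\eta_t$;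 a 2-cell $(f,\psi)\Rightarrow(g,\phi)$ is a 2-cell $\rho:f\Rightarrow gt$ in $\mathcal{K}$ with $(1_g\odot\mu_t)(\rho\odot1_t)\psi=(1_g\odot\mu_t)(\phi\odot1_t)(1_r\odot\rho)$. The vertical composite of $\rho:(f,\psi)\Rightarrow(g,\phi)$ and $\rho':(g,\phi)\Rightarrow(h,\gamma)$ is $(1_h\odot\mu_t)(\rho'\odot1_t)\rho$; composition of 1-cells is $(g,\phi)(f,\psi)=(gf,(1_g\odot\psi)(\phi\odot1_f))$; the horizontal composite of $\rho:(f,\psi)\Rightarrow(f',\psi')$ and $\rho':(g,\phi)\Rightarrow(g',\phi')$ is $\rho'\oslash\rho=(1_{g'}\odot1_{f'}\odot\mu_t)(1_{g'}\odot\rho\odot1_t)(1_{g'}\odot\psi)(\rho'\odot1_f)$; the identity 2-cell of $(f,\psi)$ is $1_f\odot\eta_t$; the identity 1-cell of $\mathbb{A}=(A,t,\mu,\eta)$ is $(1_A,1_t)$. $EM(\mathcal{K})(\mathbb{A})$ is the monoidal category with objects the 1-cells $\mathbb{A}\to\mathbb{A}$, morphisms the 2-cells, $(s,\psi)\otimes(s',\psi')=(s',\psi')(s,\psi)$, $\rho\otimes\rho'=\rho'\oslash\rho$, unit $(1_A,1_t)$. A wreath in $\mathcal{K}$ is a monad in $EM(\mathcal{K})$ (a cowreath is a comonad in $EM(\mathcal{K})$). Explicitly: a monad $\mathbb{A}=(A,t,\mu,\eta)$ with a 1-cell $s:A\to A$ and 2-cells $\psi:ts\Rightarrow st$, $\sigma:1_A\Rightarrow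 st$, $\zeta:ss\Rightarrow st$ such that $(1_s\odot\mu)(\psi\odot1_t)(1_t\odot\psi)=\psi(\mu\odot1_s)$, $\psi(\eta\odot1_s)=1_s\odot\eta$; $(1_s\odot\mu)(\psi\odot1_t)(1_t\odot\sigma)=(1_s\odot\mu)(\sigma\odot1_t)$; $(1_s\odot\mu)(\psi\odot1_t)(1_t\odot\zeta)=(1_s\odot\mu)(\zeta\odot1_t)(1_s\odot\psi)(\psi\odot1_s)$; $(1_s\odot\mu)(\zeta\odot1_t)(1_s\odot\zeta)=(1_s\odot\mu)(\zeta\odot1_t)(1_s\odot\psi)(\zeta\odot1_s)$; $(1_s\odot\mu)(\zeta\odot1_t)(1_s\odot\sigma)=1_s\odot\eta$; $(1_s\odot\mu)(\zeta\odot1_t)(1_s\odot\psi)(\sigma\odot1_s)=1_s\odot\eta$. Thus $(s,\psi)$ is an algebra in $EM(\mathcal{K})(\mathbb{A})$ with multiplication $\zeta$ and unit $\sigma$. The wreath product is the monad $(A,st,\mu_{st},\sigma)$ with $\mu_{st}=(1_s\odot\mu)(\zeta\odot1_t)(1_s\odot1_s\odot\mu)(1_s\odot\psi\odot1_t)$. The morphism $\iota=(1_s\odot\mu)(\sigma\odot1_t):t\Rightarrow st$ is an algebra morphism in $\mathcal{K}(A)$, and the canonical monad extension associated to the wreath is $(1_A,\iota)$; when $\mathcal{K}(A)$ has coequalizers and all its objects are coflat, it is called Frobenius if $\iota:t\to st$ is a Frobenius algebra extension in $\mathcal{K}(A)$. General notions in a monoidal category $(\mathcal{C},\otimes,\underline{1})$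 (taken strict), $m_A,\eta_A$ denoting multiplication and unit of an algebra. An object $X$ is coflat if $X\otimes-$ and $-\otimes X$ preserve coequalizers. An algebra $A$ is Frobenius if there are $\vartheta:A\to\underline{1}$, $e:\underline{1}\to A\otimes A$ with $(m_A\otimes\mathrm{Id})(\mathrm{Id}\otimes e)=(\mathrm{Id}\otimes m_A)(e\otimes\mathrm{Id})$ and $(\vartheta\otimes\mathrm{Id})e=\eta_A=(\mathrm{Id}\otimes\vartheta)e$. An adjunction $(\rho,\lambda):Y\dashv X$ consists of $\rho:\underline{1}\to X\otimes Y$, $\lambda:Y\otimes X\to\underline{1}$ with $(\mathrm{Id}_X\otimes\lambda)(\rho\otimes\mathrm{Id}_X)=\mathrm{Id}_X$, $(\lambda\otimes\mathrm{Id}_Y)(\mathrm{Id}_Y\otimes\rho)=\mathrm{Id}_Y$. If $\mathcal{C}$ has coequalizers and all objects are coflat, an algebra morphism (extension) $i:R\to S$ is Frobenius if there are an $R$-bimodule morphism $\vartheta:S\to R$ and a morphism $e:\underline{1}\to S\otimes_RS$ with $\mu^S(\mathrm{Id}_S\otimes e)=\nu^S(e\otimes\mathrm{Id}_S)$, $\Upsilon_S\tilde\vartheta e=\eta_S$ and $\Upsilon'_S\hat\vartheta e=\eta_S$. Here $q^R_{X,Y}:X\otimes Y\to X\otimes_RY$ is the coequalizer of the two morphisms $X\otimes R\otimes Y\to X\otimes Y$ given by the right action on $X$ and the left action on $Y$; $S$ is an $R$-bimodule via $i$; $\mu^S(\mathrm{Id}_S\otimes q^R_{S,S})=q^R_{S,S}(m_S\otimes\mathrm{Id}_S)$,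 $\nu^S(q^R_{S,S}\otimes\mathrm{Id}_S)=q^R_{S,S}(\mathrm{Id}_S\otimes m_S)$; $\tilde\vartheta q^R_{S,S}=q^R_{S,R}(\mathrm{Id}_S\otimes\vartheta)$, $\hat\vartheta q^R_{S,S}=q^R_{R,S}(\vartheta\otimes\mathrm{Id}_S)$; and $\Upsilon_S:S\otimes_RR\to S$, $\Upsilon'_S:R\otimes_RS\to S$ are the canonical isomorphisms induced by the actions. *)

(* Defs.v *)
From Stdlib Require Import ssreflect ssrfun ssrbool Classical ClassicalEpsilon.

Set Implicit Arguments.
Unset Strict Implicit.
Unset Printing Implicit Defensive.

Declare Scope cell_scope.
Delimit Scope cell_scope with cell.
Open Scope cell_scope.

Record category := Category {
  ob :> Type;
  hom : ob -> ob -> Type;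
  Id : forall x, hom x x;
  comp : forall x y z, hom y z -> hom x y -> hom x z;
  compA : forall w x y z (c : hom y z) (b : hom x y) (a : hom w x),
    comp c (comp b a) = comp (comp c b) a;
  comp1m : forall x y (a : hom x y), comp (Id y) a = a;
  compm1 : forall x y (a : hom x y), comp a (Id x) = a
}.

Arguments hom {_} _ _.
Arguments Id {_} _.
Arguments comp {_ _ _ _} _ _.

(* In a strict 2-category (or strict monoidal category) the composition of
   1-cells (the tensor product of objects) is associative and unital up to
   propositional equality only, so both sides of an equation between 2-cells
   may live in types that are equal but not convertible.  [a ≡ b] says that [a]
   and [b] are equal as elements of the collection of all morphisms: they have
   equal sources, equal targets, and are equal. *)
Inductive meq (C : category) (x y : C) (a : hom x y) :
    forall x' y' : C, hom x' y' -> Prop :=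
  meq_refl : meq a a.

Notation "a ≡ b" := (meq a b) (at level 70, no associativity) : cell_scope.

(* [streq x y] is [x = y], as a class; its instances are found by rewriting with
   the strict associativity and unit laws (see the hints below). *)
Class streq (T : Type) (x y : T) : Prop := streqE : x = y.

(* The identity of [x], seen as a morphism to the equal object [y].  It does not
   depend on the proof [e], by proof irrelevance. *)
Definition idc (C : category) (x y : C) {e : streq x y} : hom x y :=
  eq_rect x (fun w => hom x w) (Id x) y e.

Arguments idc {C} x y {e}.

(* Vertical composition [b ∙ a] of [a : x -> y] and [b : y' -> z], where [y] and
   [y'] are equal by strictness. *)
Definition vcomp (C : category) (x y y' z : C) (b : hom y' z) (a : hom x y)
    {e : streq y y'} : hom x z :=
  comp b (comp (idc y y') a).

Arguments vcomp {C x y y' z} b a {e}.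

Notation "b ∙ a" := (vcomp b a) (at level 40, left associativity) : cell_scope.

(* A morphism moved to endpoints that are equal by strictness. *)
Definition cast (C : category) (x y x' y' : C) (a : hom x y)
    {e : streq x' x} {e' : streq y y'} : hom x' y' :=
  comp (idc y y') (comp a (idc x' x)).

Arguments cast {C x y x' y'} a {e e'}.

Notation "⟨ a ⟩" := (cast a) : cell_scope.

Record twocat := TwoCat {
  cell0 :> Type;
  hcat : cell0 -> cell0 -> category;
  id1 : forall A, hcat A A;
  comp1 : forall A B C, hcat B C -> hcat A B -> hcat A C;
  hcomp : forall A B C (g g' : hcat B C) (f f' : hcat A B),
    hom g g' -> hom f f' -> hom (comp1 g f) (comp1 g' f');
  hcomp_id : forall A B C (g : hcat B C) (f : hcat A B),
    hcomp (Id g) (Id f) = Id (comp1 g f);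
  hcomp_comp : forall A B C (g g' g'' : hcat B C) (f f' f'' : hcat A B)
      (b' : hom g' g'') (b : hom g g') (a' : hom f' f'') (a : hom f f'),
    hcomp (comp b' b) (comp a' a) = comp (hcomp b' a') (hcomp b a);
  comp1A : forall A B C D (h : hcat C D) (g : hcat B C) (f : hcat A B),
    comp1 h (comp1 g f) = comp1 (comp1 h g) f;
  comp11f : forall A B (f : hcat A B), comp1 (id1 B) f = f;
  comp1f1 : forall A B (f : hcat A B), comp1 f (id1 A) = f;
  hcompA : forall A B C D (h h' : hcat C D) (g g' : hcat B C) (f f' : hcat A B)
      (c : hom h h') (b : hom g g') (a : hom f f'),
    hcomp c (hcomp b a) ≡ hcomp (hcomp c b) a;
  hcomp1a : forall A B (f f' : hcat A B) (a : hom f f'),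
    hcomp (Id (id1 B)) a ≡ a;
  hcompa1 : forall A B (f f' : hcat A B) (a : hom f f'),
    hcomp a (Id (id1 A)) ≡ a
}.

Arguments hcat {_} _ _.
Arguments id1 {_} _.
Arguments comp1 {_ _ _ _} _ _.
Arguments hcomp {_ _ _ _ _ _ _ _} _ _.

Notation "g · f" := (comp1 g f) (at level 37, left associativity) : cell_scope.
Notation "b ⊙ a" := (hcomp b a) (at level 38, left associativity) : cell_scope.

Lemma comp1AV (K : twocat) (A B C D : K)
    (h : hcat C D) (g : hcat B C) (f : hcat A B) : (h · g) · f = h · (g · f).
Proof. by rewrite comp1A. Qed.

(* Strict monoidal categories; as for 2-categories, associativity and unitality
   of the tensor product of objects are propositional equalities. *)
Record moncat := MonCat {
  mcat :> category;
  tunit : mcat;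
  ten : mcat -> mcat -> mcat;
  tenh : forall x x' y y' : mcat,
    hom x x' -> hom y y' -> hom (ten x y) (ten x' y');
  tenh_id : forall x y : mcat, tenh (Id x) (Id y) = Id (ten x y);
  tenh_comp : forall (x x' x'' y y' y'' : mcat)
      (b' : hom x' x'') (b : hom x x') (a' : hom y' y'') (a : hom y y'),
    tenh (comp b' b) (comp a' a) = comp (tenh b' a') (tenh b a);
  tenA : forall x y z : mcat, ten x (ten y z) = ten (ten x y) z;
  ten1x : forall x : mcat, ten tunit x = x;
  tenx1 : forall x : mcat, ten x tunit = x;
  tenhA : forall (x x' y y' z z' : mcat) (c : hom x x') (b : hom y y')
      (a : hom z z'),
    tenh c (tenh b a) ≡ tenh (tenh c b) a;
  tenh1a : forall (x x' : mcat) (a : hom x x'), tenh (Id tunit) a ≡ a;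
  tenha1 : forall (x x' : mcat) (a : hom x x'), tenh a (Id tunit) ≡ a
}.

Arguments tunit {_}.
Arguments ten {_} _ _.
Arguments tenh {_ _ _ _ _} _ _.

Notation "x ⊗ y" := (ten x y) (at level 37, left associativity) : cell_scope.
Notation "b ⊗ₘ a" := (tenh b a) (at level 38, left associativity) : cell_scope.

Lemma tenAV (M : moncat) (x y z : M) : (x ⊗ y) ⊗ z = x ⊗ (y ⊗ z).
Proof. by rewrite tenA. Qed.

Ltac strict1 := rewrite ?comp1AV ?comp11f ?comp1f1 ?comp1AV ?comp11f ?comp1f1.

#[export] Hint Extern 0 (streq _ _) =>
  solve [ exact eq_refl | unfold streq; 
    rewrite ?(tenAV, ten1x, tenx1); repeat (progress strict1); exact eq_refl ]
  : typeclass_instances.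

Record monad (K : twocat) := Monad {
  mob : K;
  mcar : hcat mob mob;
  mmul : hom (mcar · mcar) mcar;
  munit : hom (id1 mob) mcar;
  mmulA : mmul ∙ (mmul ⊙ Id mcar) ≡ mmul ∙ (Id mcar ⊙ mmul);
  mmul1m : mmul ∙ (munit ⊙ Id mcar) ≡ Id mcar;
  mmulm1 : mmul ∙ (Id mcar ⊙ munit) ≡ Id mcar
}.

Definition frobenius_monad (K : twocat) (T : monad K) : Prop :=
  let t := mcar T in
  exists (theta : hom t (id1 (mob T))) (e : hom (id1 (mob T)) (t · t)),
    [/\ (mmul T ⊙ Id t) ∙ (Id t ⊙ e) ≡ (Id t ⊙ mmul T) ∙ (e ⊙ Id t),
        (theta ⊙ Id t) ∙ e ≡ munit T
      & (Id t ⊙ theta) ∙ e ≡ munit T].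

(* The monoidal category [K(U)]: the tensor product of [X] and [Y] is [XY]. *)
Definition hom_moncat (K : twocat) (U : K) : moncat :=
  @MonCat (hcat U U) (id1 U) (fun g f => g · f)
    (fun g g' f f' b a => b ⊙ a)
    (fun g f => hcomp_id g f)
    (fun g g' g'' f f' f'' b' b a' a => hcomp_comp b' b a' a)
    (fun h g f => comp1A h g f) (fun f => comp11f f) (fun f => comp1f1 f)
    (fun h h' g g' f f' c b a => hcompA c b a)
    (fun f f' a => hcomp1a a) (fun f f' a => hcompa1 a).

Lemma meq_sym (C : category) (x y x' y' : C) (a : hom x y) (b : hom x' y') :
  a ≡ b -> b ≡ a.
Proof. by case. Qed.

Definition rev_moncat (M : moncat) : moncat :=
  @MonCat M tunit (fun x y => y ⊗ x) (fun x x' y y' b a => a ⊗ₘ b)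
    (fun x y => tenh_id y x)
    (fun x x' x'' y y' y'' b' b a' a => tenh_comp a' a b' b)
    (fun x y z => esym (tenA z y x)) (fun x => tenx1 x) (fun x => ten1x x)
    (fun x x' y y' z z' c b a => meq_sym (tenhA a b c))
    (fun x x' a => tenha1 a) (fun x x' a => tenh1a a).

Record algebra (M : moncat) := Algebra {
  acar :> M;
  amul : hom (acar ⊗ acar) acar;
  aone : hom tunit acar;
  amulA : amul ∙ (amul ⊗ₘ Id acar) ≡ amul ∙ (Id acar ⊗ₘ amul);
  amul1m : amul ∙ (aone ⊗ₘ Id acar) ≡ Id acar;
  amulm1 : amul ∙ (Id acar ⊗ₘ aone) ≡ Id acar
}.

Definition frobenius_algebra (M : moncat) (S : algebra M) : Prop :=
  exists (theta : hom (acar S) tunit) (e : hom tunit (S ⊗ S)),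
    [/\ (amul S ⊗ₘ Id (acar S)) ∙ (Id (acar S) ⊗ₘ e)
          ≡ (Id (acar S) ⊗ₘ amul S) ∙ (e ⊗ₘ Id (acar S)),
        (theta ⊗ₘ Id (acar S)) ∙ e ≡ aone S
      & (Id (acar S) ⊗ₘ theta) ∙ e ≡ aone S].

Record coalgebra_on (M : moncat) (X : M) := CoalgebraOn {
  comul : hom X (X ⊗ X);
  counit : hom X tunit;
  comulA : (comul ⊗ₘ Id X) ∙ comul ≡ (Id X ⊗ₘ comul) ∙ comul;
  counitl : (counit ⊗ₘ Id X) ∙ comul ≡ Id X;
  counitr : (Id X ⊗ₘ counit) ∙ comul ≡ Id X
}.

(* [(rho, lambda) : Y ⊣ X] *)
Definition adjunction (M : moncat) (Y X : M)
    (rho : hom tunit (X ⊗ Y)) (lambda : hom (Y ⊗ X) tunit) : Prop :=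
  (Id X ⊗ₘ lambda) ∙ (rho ⊗ₘ Id X) ≡ Id X /\
  (lambda ⊗ₘ Id Y) ∙ (Id Y ⊗ₘ rho) ≡ Id Y.

Definition is_coequalizer (C : category) (x y q : C) (f g : hom x y)
    (c : hom y q) : Prop :=
  comp c f = comp c g /\
  forall (z : C) (h : hom y z), comp h f = comp h g ->
    exists! k : hom q z, comp k c = h.

Record coequalizers (C : category) := Coequalizers {
  coeq : forall x y : C, hom x y -> hom x y -> C;
  coeq_map : forall (x y : C) (f g : hom x y), hom y (coeq f g);
  coeqP : forall (x y : C) (f g : hom x y), is_coequalizer f g (coeq_map f g)
}.

Definition coflat (M : moncat) (X : M) : Prop :=
  forall (x y q : M) (f g : hom x y) (c : hom y q), is_coequalizer f g c ->
    is_coequalizer (Id X ⊗ₘ f) (Id X ⊗ₘ g) (Id X ⊗ₘ c) /\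
    is_coequalizer (f ⊗ₘ Id X) (g ⊗ₘ Id X) (c ⊗ₘ Id X).

Record alg_hom (M : moncat) (R S : algebra M) := AlgHom {
  ahom :> hom (acar R) (acar S);
  ahom_mul : ahom ∙ amul R ≡ amul S ∙ (ahom ⊗ₘ ahom);
  ahom_one : ahom ∙ aone R ≡ aone S
}.

Section Extensions.
Variables (M : moncat) (Q : coequalizers M) (R S : algebra M) (i : alg_hom R S).

(* [X ⊗_R Y] and [q^R_{X,Y}], for a right action [r] on [X] and a left action
   [l] on [Y]. *)
Definition rten (X Y : M) (r : hom (X ⊗ R) X) (l : hom (R ⊗ Y) Y) : M :=
  coeq Q (r ⊗ₘ Id Y) ⟨Id X ⊗ₘ l⟩.
Definition rten_map (X Y : M) (r : hom (X ⊗ R) X) (l : hom (R ⊗ Y) Y) :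
    hom (X ⊗ Y) (rten r l) :=
  coeq_map Q (r ⊗ₘ Id Y) ⟨Id X ⊗ₘ l⟩.

Definition ext_lact : hom (R ⊗ S) (acar S) := amul S ∙ (i ⊗ₘ Id (acar S)).
Definition ext_ract : hom (S ⊗ R) (acar S) := amul S ∙ (Id (acar S) ⊗ₘ i).

Definition ext_bimodule_hom (theta : hom (acar S) (acar R)) : Prop :=
  theta ∙ ext_lact ≡ amul R ∙ (Id (acar R) ⊗ₘ theta) /\
  theta ∙ ext_ract ≡ amul R ∙ (theta ⊗ₘ Id (acar R)).

(* The equations on [muS], [nuS], [tht], [thh], [Ups], [Ups'] determine these
   morphisms uniquely: they are the factorizations through the coequalizers
   [q^R], or through [S ⊗ q^R] and [q^R ⊗ S], which are coequalizers when [S]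
   is coflat. *)
Definition frobenius_extension : Prop :=
  let SS := rten ext_ract ext_lact in
  let SR := rten ext_ract (amul R) in
  let RS := rten (amul R) ext_lact in
  let qSS := rten_map ext_ract ext_lact in
  let qSR := rten_map ext_ract (amul R) in
  let qRS := rten_map (amul R) ext_lact in
  let IdS := Id (acar S) in
  exists (muS : hom (S ⊗ SS) SS) (nuS : hom (SS ⊗ S) SS)
      (Ups : hom SR (acar S)) (Ups' : hom RS (acar S)),
    [/\ muS ∙ (IdS ⊗ₘ qSS) ≡ qSS ∙ (amul S ⊗ₘ IdS),
        nuS ∙ (qSS ⊗ₘ IdS) ≡ qSS ∙ (IdS ⊗ₘ amul S),
        Ups ∙ qSR ≡ ext_ract
      & Ups' ∙ qRS ≡ ext_lact] /\
  exists (theta : hom (acar S) (acar R)) (tht : hom SS SR) (thh : hom SS RS)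
      (e : hom tunit SS),
    [/\ ext_bimodule_hom theta,
        tht ∙ qSS ≡ qSR ∙ (IdS ⊗ₘ theta)
      & thh ∙ qSS ≡ qRS ∙ (theta ⊗ₘ IdS)] /\
    [/\ muS ∙ (IdS ⊗ₘ e) ≡ nuS ∙ (e ⊗ₘ IdS),
        Ups ∙ tht ∙ e ≡ aone S
      & Ups' ∙ thh ∙ e ≡ aone S].

End Extensions.

(* Total (option-valued) composition of morphisms with their endpoints packed;
   it is used only in proofs of equations between morphisms. *)
Section Chains.
Variable C : category.

Definition arr := option {x : C & {y : C & hom x y}}.

Definition pk (x y : C) (a : hom x y) : arr :=
  Some (existT _ x (existT (fun y => hom x y) y a)).

Definition aid (x : C) : arr := pk (Id x).

Definition acomp (q p : arr) : arr :=
  match q, p with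
  | Some (existT _ y' (existT _ z b)), Some (existT _ x (existT _ y a)) =>
      match excluded_middle_informative (y = y') with
      | left e => pk (comp b (eq_rect y (fun w => hom x w) a y' e))
      | right _ => None
      end
  | _, _ => None
  end.

Lemma pk_meq (x y x' y' : C) (a : hom x y) (b : hom x' y') :
  pk a = pk b -> a ≡ b.
Proof.
move=> e.
pose P (c : arr) := if c is Some (existT _ _ (existT _ _ c')) then a ≡ c' else True.
have: P (pk a) by [].
by rewrite e.
Qed.

Lemma meq_pk (x y x' y' : C) (a : hom x y) (b : hom x' y') :
  a ≡ b -> pk a = pk b.
Proof. by case. Qed.

Lemma meq_eq (x y : C) (a b : hom x y) : a ≡ b -> a = b.
Proof.
move=> ab.
pose P (x' y' : C) (c : hom x' y') := forall (ex : x = x') (ey : y = y'),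
  eq_rect x (fun w => hom w y') (eq_rect y (fun w => hom x w) a y' ey) x' ex = c.
have: P _ _ b.
  by case: ab => ex ey; rewrite (proof_irrelevance _ ex eq_refl)
    (proof_irrelevance _ ey eq_refl).
by move/(_ eq_refl eq_refl).
Qed.

Lemma pk_comp (x y z : C) (b : hom y z) (a : hom x y) :
  pk (comp b a) = acomp (pk b) (pk a).
Proof.
rewrite /= ; case: excluded_middle_informative => [e|//].
by rewrite (proof_irrelevance _ e eq_refl).
Qed.

Lemma pk_idc (x y : C) (e : streq x y) : pk (idc x y) = aid x.
Proof. by rewrite /idc; case: y / e. Qed.

Lemma acompA (r q p : arr) : acomp r (acomp q p) = acomp (acomp r q) p.
Proof.
case: r q p => [[y2 [z c]]|] [[y1 [y1' b]]|] [[x [y a]]|] //=.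
- case: excluded_middle_informative => [e|ne] /=;
    last by case: excluded_middle_informative => //= ? ;
      case: excluded_middle_informative.
  case: y1 / e b => b; rewrite /=.
  case: excluded_middle_informative => [e|ne] //=.
  case: y2 / e c => c /=.
  case: excluded_middle_informative => [e|//].
  by rewrite (proof_irrelevance _ e eq_refl) /= compA.
- by case: excluded_middle_informative.
Qed.

Lemma aidl (x y y' : C) (a : hom x y) : y = y' -> acomp (aid y') (pk a) = pk a.
Proof. by move=> <-; rewrite -pk_comp comp1m. Qed.

Lemma aidr (x x' y : C) (a : hom x y) : x = x' -> acomp (pk a) (aid x') = pk a.
Proof. by move=> <-; rewrite -pk_comp compm1. Qed.

Lemma pk_vcomp (x y y' z : C) (b : hom y' z) (a : hom x y) (e : streq y y') :
  pk (b ∙ a) = acomp (pk b) (pk a).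
Proof. by rewrite /vcomp !pk_comp pk_idc aidl. Qed.

End Chains.

Arguments aid {C} x.
Arguments acomp : simpl never.
Arguments pk : simpl never.
Arguments aid : simpl never.

Local Notation "q ** p" := (acomp q p) (at level 41, right associativity).

Section Whiskering.
Variable K : twocat.

Definition W (A B C D : K) (f : hcat C D) (x y : hcat B C) (a : hom x y)
    (g : hcat A B) : arr (hcat A D) :=
  pk (Id f ⊙ a ⊙ Id g).

Lemma W_meq (A B C D : K) (f : hcat C D) (x y x' y' : hcat B C) (a : hom x y)
    (b : hom x' y') (g : hcat A B) : a ≡ b -> W f a g = W f b g.
Proof. by case. Qed.

Lemma hcomp_meq (A B C : K) (g1 g2 g3 g4 : hcat B C) (f1 f2 f3 f4 : hcat A B)
    (b : hom g1 g2) (b' : hom g3 g4) (a : hom f1 f2) (a' : hom f3 f4) :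
  b ≡ b' -> a ≡ a' -> pk (b ⊙ a) = pk (b' ⊙ a').
Proof. by case; case. Qed.

Lemma W1 (A B : K) (x y : hcat A B) (a : hom x y) : W (id1 B) a (id1 A) = pk a.
Proof.
rewrite /W (hcomp_meq (hcomp1a a) (meq_refl (Id (id1 A)))).
exact/meq_pk/hcompa1.
Qed.

Lemma W_comp (A B C D : K) (f : hcat C D) (x y z : hcat B C) (b : hom y z)
    (a : hom x y) (g : hcat A B) : W f (comp b a) g = W f b g ** W f a g.
Proof.
by rewrite /W -pk_comp -!hcomp_comp !comp1m.
Qed.

Lemma W_id (A B C D : K) (f : hcat C D) (h : hcat B C) (g : hcat A B) :
  W f (Id h) g = aid (f · (h · g)).
Proof. by rewrite /W !hcomp_id comp1AV. Qed.

Lemma W_idc (A B C D : K) (f : hcat C D) (h k : hcat B C) (e : streq h k)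
    (g : hcat A B) : W f (idc h k) g = aid (f · (h · g)).
Proof. by rewrite /idc; case: k / e; rewrite W_id. Qed.

Lemma W_vcomp (A B C D : K) (f : hcat C D) (x y y' z : hcat B C) (b : hom y' z)
    (a : hom x y) (e : streq y y') (g : hcat A B) :
  W f (b ∙ a) g = W f b g ** W f a g.
Proof.
rewrite /vcomp !W_comp W_idc {2}/W aidl //.
by rewrite (e : y = y') comp1A.
Qed.

Lemma W_cast (A B C D : K) (f : hcat C D) (x y x' y' : hcat B C) (a : hom x y)
    (e : streq x' x) (e' : streq y y') (g : hcat A B) :
  W f (cast (x' := x') (y' := y') a) g = W f a g.
Proof.
rewrite /cast !W_comp !W_idc {2}/W aidr ?aidl //; rewrite comp1AV //.
by rewrite (e : x' = x).
Qed.

Lemma W_l (A B C D E : K) (f : hcat D E) (h : hcat C D) (x y : hcat B C)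
    (a : hom x y) (g : hcat A B) : W f (Id h ⊙ a) g = W (f · h) a g.
Proof.
rewrite /W; apply: hcomp_meq => //; rewrite -hcomp_id; exact: hcompA.
Qed.

Lemma W_r (A B C D E : K) (f : hcat D E) (x y : hcat C D)
    (a : hom x y) (h : hcat B C) (g : hcat A B) :
  W f (a ⊙ Id h) g = W f a (h · g).
Proof.
rewrite /W -(hcomp_id h g); transitivity (pk ((Id f ⊙ a ⊙ Id h) ⊙ Id g)).
  by apply: hcomp_meq => //; exact: hcompA.
by apply/esym/meq_pk; exact: hcompA.
Qed.

Lemma W_h (A B C D E : K) (f : hcat D E) (x x' : hcat C D) (y y' : hcat B C)
    (b : hom x x') (a : hom y y') (g : hcat A B) :
  W f (b ⊙ a) g = W f b (y' · g) ** W (f · x) a g.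
Proof.
by rewrite -W_l -W_r -W_comp -hcomp_comp comp1m compm1.
Qed.

Lemma W_hV (A B C D E : K) (f : hcat D E) (x x' : hcat C D) (y y' : hcat B C)
    (b : hom x x') (a : hom y y') (g : hcat A B) :
  W f (b ⊙ a) g = W (f · x') a g ** W f b (y · g).
Proof.
by rewrite -W_l -W_r -W_comp -hcomp_comp comp1m compm1.
Qed.

Lemma W_ll (A B C D E F : K) (f : hcat E F) (h : hcat D E) (k : hcat C D)
    (x y : hcat B C) (a : hom x y) (g : hcat A B) :
  W f (Id h ⊙ Id k ⊙ a) g = W (f · (h · k)) a g.
Proof. by rewrite hcomp_id W_l. Qed.

Lemma Wx (A B B' C D E : K) (f : hcat D E) (x x' : hcat C D) (m : hcat B' C)
    (y y' : hcat B B') (b : hom x x') (a : hom y y') (g : hcat A B) :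
  W f b (m · (y' · g)) ** W (f · (x · m)) a g =
  W (f · (x' · m)) a g ** W f b (m · (y · g)).
Proof.
have := W_hV f b (Id m ⊙ a) g; rewrite W_h !W_l.
by rewrite !comp1AV.
Qed.

Lemma Waidl (A B C D : K) (f : hcat C D) (x y : hcat B C) (a : hom x y)
    (g : hcat A B) z : z = f · (y · g) -> aid z ** W f a g = W f a g.
Proof. by move=> ->; rewrite /W aidl // comp1A. Qed.

Lemma Waidr (A B C D : K) (f : hcat C D) (x y : hcat B C) (a : hom x y)
    (g : hcat A B) z : z = f · (x · g) -> W f a g ** aid z = W f a g.
Proof. by move=> ->; rewrite /W aidr // comp1A. Qed.

End Whiskering.

Arguments W : simpl never.

Ltac s1 := repeat (progress strict1).
Ltac wn := rewrite ?(W_vcomp, W_cast, W_comp, W_ll, W_l, W_r, W_h, W_id, W_idc); s1;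
  rewrite -?acompA.
Ltac wstart := apply: pk_meq; rewrite -[LHS]W1 -[RHS]W1 /=; wn.

Lemma tail2 (C : category) (a b d : arr C) :
  a ** b = d -> forall p, a ** b ** p = d ** p.
Proof. by move=> <- p; rewrite !acompA. Qed.

Lemma tail3 (C : category) (a b c d : arr C) :
  a ** b ** c = d -> forall p, a ** b ** c ** p = d ** p.
Proof. by move=> <- p; rewrite !acompA. Qed.

Lemma tail4 (C : category) (a b c b' d : arr C) :
  a ** b ** c ** b' = d -> forall p, a ** b ** c ** b' ** p = d ** p.
Proof. by move=> <- p; rewrite !acompA. Qed.

Ltac use H :=
  let E := fresh "E" in
  move: H; s1; rewrite -?acompA => E;
  first [ rewrite (tail4 E) | rewrite (tail3 E) | rewrite (tail2 E) | rewrite E ];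
  clear E; rewrite -?acompA.

Lemma aid2 (C : category) (x : C) : aid x ** aid x = aid x.
Proof. exact: aidl. Qed.

Lemma Waidlt (K : twocat) (A B C D : K) (f : hcat C D) (x y : hcat B C)
    (a : hom x y) (g : hcat A B) z p :
  z = f · (y · g) -> aid z ** W f a g ** p = W f a g ** p.
Proof. by move=> e; rewrite acompA Waidl. Qed.

Ltac unit_rules := repeat first
  [ rewrite aid2 | rewrite Waidlt; try by s1 | rewrite Waidl; try by s1
  | rewrite Waidr; try by s1 ].

Section EM.
Variable K : twocat.

Record em1 (T R : monad K) := Em1 {
  em_car : hcat (mob T) (mob R);
  em_psi : hom (mcar R · em_car) (em_car · mcar T);
  em_psi_mul :
    (Id em_car ⊙ mmul T) ∙ (em_psi ⊙ Id (mcar T)) ∙ (Id (mcar R) ⊙ em_psi)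
      ≡ em_psi ∙ (mmul R ⊙ Id em_car);
  em_psi_unit : em_psi ∙ (munit R ⊙ Id em_car) ≡ Id em_car ⊙ munit T
}.

Record em2 (T R : monad K) (F G : em1 T R) := Em2 {
  em_cell : hom (em_car F) (em_car G · mcar T);
  em_cellP :
    (Id (em_car G) ⊙ mmul T) ∙ (em_cell ⊙ Id (mcar T)) ∙ em_psi F
      ≡ (Id (em_car G) ⊙ mmul T) ∙ (em_psi G ⊙ Id (mcar T))
          ∙ (Id (mcar R) ⊙ em_cell)
}.

Section Rules.
Variables (A B : K).

Lemma mmulAW (T : monad K) (f : hcat (mob T) B) (g : hcat A (mob T)) :
  W f (mmul T) g ** W f (mmul T) (mcar T · g) =
  W f (mmul T) g ** W (f · mcar T) (mmul T) g.
Proof. by have := W_meq f g (mmulA T); wn. Qed.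

Lemma mmul1mW (T : monad K) (f : hcat (mob T) B) (g : hcat A (mob T)) :
  W f (mmul T) g ** W f (munit T) (mcar T · g) = aid (f · (mcar T · g)).
Proof. by have := W_meq f g (mmul1m T); wn. Qed.

Lemma mmulm1W (T : monad K) (f : hcat (mob T) B) (g : hcat A (mob T)) :
  W f (mmul T) g ** W (f · mcar T) (munit T) g = aid (f · (mcar T · g)).
Proof. by have := W_meq f g (mmulm1 T); wn. Qed.

Variables (T R : monad K) (f : hcat (mob R) B) (g : hcat A (mob T)).

Lemma psi_mulW (F : em1 T R) :
  W (f · em_car F) (mmul T) g ** W f (em_psi F) (mcar T · g)
    ** W (f · mcar R) (em_psi F) g =
  W f (em_psi F) g ** W f (mmul R) (em_car F · g).
Proof. by have := W_meq f g (em_psi_mul F); wn. Qed.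

Lemma psi_unitW (F : em1 T R) :
  W f (em_psi F) g ** W f (munit R) (em_car F · g) =
  W (f · em_car F) (munit T) g.
Proof. by have := W_meq f g (em_psi_unit F); wn. Qed.

Lemma cellW (F G : em1 T R) (a : em2 F G) :
  W (f · em_car G) (mmul T) g ** W f (em_cell a) (mcar T · g) ** W f (em_psi F) g =
  W (f · em_car G) (mmul T) g ** W f (em_psi G) (mcar T · g)
    ** W (f · mcar R) (em_cell a) g.
Proof. by have := W_meq f g (em_cellP a); wn. Qed.

End Rules.

Lemma em1_eq (T R : monad K) (F G : em1 T R) :
  em_car F = em_car G -> pk (em_psi F) = pk (em_psi G) -> F = G.
Proof.
case: F G => [f psi p1 p2] [g phi q1 q2] /= e; case: g / e phi q1 q2.
move=> phi q1 q2 /pk_meq/meq_eq e; case: phi / e q1 q2 => q1 q2.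
by rewrite (proof_irrelevance _ p1 q1) (proof_irrelevance _ p2 q2).
Qed.

Lemma em2_eq (T R : monad K) (F G : em1 T R) (a b : em2 F G) :
  pk (em_cell a) = pk (em_cell b) -> a = b.
Proof.
case: a b => [a p] [b q] /= /pk_meq/meq_eq e; case: b / e q => q.
by rewrite (proof_irrelevance _ p q).
Qed.

Local Notation i1 := (id1 _).

Definition em2_id (T R : monad K) (F : em1 T R) : em2 F F.
Proof.
exists ⟨Id (em_car F) ⊙ munit T⟩.
wstart.
use (mmul1mW (em_car F) i1 (T := T)).
use (Wx i1 i1 (em_psi F) (munit T) i1).
use (mmulm1W (em_car F) i1 (T := T)).
by unit_rules.
Defined.

Definition em2_comp (T R : monad K) (F G H : em1 T R) (b : em2 G H) (a : em2 F G) :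
  em2 F H.
Proof.
exists ((Id (em_car H) ⊙ mmul T) ∙ (em_cell b ⊙ Id (mcar T)) ∙ em_cell a).
wstart.
use (mmulAW (T := T) (em_car H) i1).
use (esym (Wx i1 i1 (em_cell b) (mmul T) i1)).
use (cellW i1 i1 a).
use (Wx i1 i1 (em_cell b) (mmul T) i1).
use (esym (mmulAW (T := T) (em_car H) i1)).
use (cellW i1 (mcar T) b).
use (mmulAW (T := T) (em_car H) i1).
by use (esym (Wx i1 i1 (em_psi H) (mmul T) i1)).
Defined.

Definition em1_id (T : monad K) : em1 T T.
Proof.
exists (id1 (mob T)) ⟨Id (mcar T)⟩.
  by wstart; unit_rules.
by wstart; unit_rules.
Defined.

Definition em1_comp (S T R : monad K) (G : em1 T R) (F : em1 S T) : em1 S R.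
Proof.
exists (em_car G · em_car F)
  ⟨(Id (em_car G) ⊙ em_psi F) ∙ (em_psi G ⊙ Id (em_car F))⟩.
- wstart.
  use (Wx i1 i1 (em_psi G) (em_psi F) i1).
  use (psi_mulW (em_car G) i1 F).
  use (psi_mulW i1 (em_car F) G).
  by [].
- wstart.
  use (psi_unitW i1 (em_car F) G).
  by use (psi_unitW (em_car G) i1 F).
Defined.

Definition em2_hcomp (S T R : monad K) (G G' : em1 T R) (F F' : em1 S T)
    (b : em2 G G') (a : em2 F F') : em2 (em1_comp G F) (em1_comp G' F').
Proof.
exists ((Id (em_car G') ⊙ Id (em_car F') ⊙ mmul S)
         ∙ (Id (em_car G') ⊙ em_cell a ⊙ Id (mcar S))
         ∙ (Id (em_car G') ⊙ em_psi F) ∙ (em_cell b ⊙ Id (em_car F))).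
wstart.
use (Wx i1 i1 (em_cell b) (em_psi F) i1).
use (mmulAW (T := S) (em_car G' · em_car F') i1).
use (esym (Wx (em_car G') i1 (em_cell a) (mmul S) i1)).
use (psi_mulW (em_car G') i1 F).
use (cellW i1 (em_car F) b).
use (esym (psi_mulW (em_car G') i1 F)).
use (Wx (em_car G') i1 (em_cell a) (mmul S) i1).
use (esym (mmulAW (T := S) (em_car G' · em_car F') i1)).
use (cellW (em_car G') (mcar S) a).
use (mmulAW (T := S) (em_car G' · em_car F') i1).
use (esym (Wx (em_car G') i1 (em_psi F') (mmul S) i1)).
use (esym (Wx i1 i1 (em_psi G') (em_psi F) i1)).
use (esym (Wx i1 i1 (em_psi G') (em_cell a) (mcar S))).

use (esym (Wx i1 (em_car F') (em_psi G') (mmul S) i1)).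
done.
Defined.

Lemma em2_compA (T R : monad K) (F G H I : em1 T R) (c : em2 H I) (b : em2 G H)
    (a : em2 F G) : em2_comp c (em2_comp b a) = em2_comp (em2_comp c b) a.
Proof.
apply/em2_eq/meq_pk; wstart.
use (Wx i1 i1 (em_cell c) (mmul T) i1).
by use (esym (mmulAW (T := T) (em_car I) i1)).
Qed.

Lemma em2_comp1m (T R : monad K) (F G : em1 T R) (a : em2 F G) :
  em2_comp (em2_id G) a = a.
Proof.
apply/em2_eq/meq_pk; wstart.
use (mmul1mW (T := T) (em_car G) i1).
by unit_rules.
Qed.

Lemma em2_compm1 (T R : monad K) (F G : em1 T R) (a : em2 F G) :
  em2_comp a (em2_id F) = a.
Proof.
apply/em2_eq/meq_pk; wstart.
use (Wx i1 i1 (em_cell a) (munit T) i1).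
use (mmulm1W (T := T) (em_car G) i1).
by unit_rules.
Qed.

Definition em_hcat (T R : monad K) : category :=
  Category (@em2_compA T R) (@em2_comp1m T R) (@em2_compm1 T R).

Lemma em2_hcomp_id (S T R : monad K) (G : em1 T R) (F : em1 S T) :
  em2_hcomp (em2_id G) (em2_id F) = em2_id (em1_comp G F).
Proof.
apply/em2_eq/meq_pk; wstart.
use (psi_unitW (em_car G) i1 F).
use (mmul1mW (T := S) (em_car G · em_car F) i1).
by unit_rules.
Qed.

Lemma em2_hcomp_comp (S T R : monad K) (G G' G'' : em1 T R)
    (F F' F'' : em1 S T) (b' : em2 G' G'') (b : em2 G G') (a' : em2 F' F'')
    (a : em2 F F') :
  em2_hcomp (em2_comp b' b) (em2_comp a' a) =
  em2_comp (em2_hcomp b' a') (em2_hcomp b a).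
Proof.
apply/em2_eq/meq_pk; wstart.
use (Wx i1 (em_car F') (em_cell b') (mmul S) i1).
use (Wx i1 i1 (em_cell b') (em_cell a) (mcar S)).
use (Wx i1 i1 (em_cell b') (em_psi F) i1).
use (mmulAW (T := S) (em_car G'' · em_car F'') i1).
use (mmulAW (T := S) (em_car G'' · em_car F'') i1).
use (esym (Wx (em_car G'') i1 (em_cell a') (mmul S) i1)).
use (esym (Wx (em_car G'') i1 (em_cell a') (mmul S) i1)).
use (Wx (em_car G'') i1 (em_psi F') (mmul S) i1).
use (esym (mmulAW (T := S) (em_car G'' · em_car F') i1)).
use (esym (cellW (em_car G'') (mcar S) a)).
use (mmulAW (T := S) (em_car G'' · em_car F') i1).
use (esym (Wx (em_car G'') i1 (em_cell a) (mmul S) i1)).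
by use (psi_mulW (em_car G'') i1 F).
Qed.

Lemma em1_compA (S T U V : monad K) (H : em1 U V) (G : em1 T U) (F : em1 S T) :
  em1_comp H (em1_comp G F) = em1_comp (em1_comp H G) F.
Proof.
apply: em1_eq; first exact: comp1A.
by apply/meq_pk; wstart.
Qed.

Lemma em1_comp1f (S T : monad K) (F : em1 S T) : em1_comp (em1_id T) F = F.
Proof.
apply: em1_eq; first exact: comp11f.
by apply/meq_pk; wstart; unit_rules.
Qed.

Lemma em1_compf1 (S T : monad K) (F : em1 S T) : em1_comp F (em1_id S) = F.
Proof.
apply: em1_eq; first exact: comp1f1.
by apply/meq_pk; wstart; unit_rules.
Qed.

Lemma em2_meq (T R : monad K) (F G F' G' : em_hcat T R) (a : em2 F G)
    (b : em2 F' G') :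
  F = F' -> G = G' -> em_cell a ≡ em_cell b -> meq (C := em_hcat T R) a b.
Proof.
move=> eF eG; case: F' / eF b => b; case: G' / eG b => b /meq_pk e.
by rewrite (em2_eq e).
Qed.

Lemma em2_hcompA (S T U V : monad K) (H H' : em1 U V) (G G' : em1 T U)
    (F F' : em1 S T) (c : em2 H H') (b : em2 G G') (a : em2 F F') :
  meq (C := em_hcat S V) (em2_hcomp c (em2_hcomp b a))
    (em2_hcomp (em2_hcomp c b) a).
Proof.
apply: em2_meq; try exact: em1_compA.
wstart.
use (Wx (em_car H') i1 (em_cell b) (em_psi F) i1).
use (mmulAW (T := S) (em_car H' · (em_car G' · em_car F')) i1).
use (esym (Wx (em_car H' · em_car G') i1 (em_cell a) (mmul S) i1)).
by use (psi_mulW (em_car H' · em_car G') i1 F).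
Qed.

Lemma em2_hcomp1a (S T : monad K) (F F' : em1 S T) (a : em2 F F') :
  meq (C := em_hcat S T) (em2_hcomp (em2_id (em1_id T)) a) a.
Proof.
apply: em2_meq; try exact: em1_comp1f.
wstart.
use (psi_unitW i1 i1 F).
use (Wx i1 i1 (em_cell a) (munit S) i1).
use (mmulm1W (T := S) (em_car F') i1).
by unit_rules.
Qed.

Lemma em2_hcompa1 (S T : monad K) (F F' : em1 S T) (a : em2 F F') :
  meq (C := em_hcat S T) (em2_hcomp a (em2_id (em1_id S))) a.
Proof.
apply: em2_meq; try exact: em1_compf1.
wstart.
use (mmul1mW (T := S) (em_car F') i1).
by unit_rules.
Qed.

Definition EM : twocat :=
  @TwoCat (monad K) em_hcat em1_id
    (fun S T R G F => @em1_comp S T R G F)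
    (fun S T R G G' F F' b a => @em2_hcomp S T R G G' F F' b a)
    em2_hcomp_id em2_hcomp_comp em1_compA em1_comp1f em1_compf1
    em2_hcompA em2_hcomp1a em2_hcompa1.

End EM.

(* A wreath [(A, t, μ, η, s, ψ, ζ, σ)] is a monad in [EM K]: its 0-cell is the
   monad [(A, t, μ, η)], its 1-cell is [(s, ψ)], its multiplication is [ζ] and its
   unit is [σ]. *)
Definition wreath (K : twocat) := monad (EM K).

Section Wreath.
Variables (K : twocat) (X : wreath K).

Definition wr_base : monad K := mob X.
Definition wr_cell0 : K := mob wr_base.
Definition wr_t : hcat wr_cell0 wr_cell0 := mcar wr_base.
Definition wr_mu : hom (wr_t · wr_t) wr_t := mmul wr_base.
Definition wr_eta : hom (id1 wr_cell0) wr_t := munit wr_base.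
Definition wr_em1 : em1 wr_base wr_base := mcar X.
Definition wr_s : hcat wr_cell0 wr_cell0 := em_car wr_em1.
Definition wr_psi : hom (wr_t · wr_s) (wr_s · wr_t) := em_psi wr_em1.
Definition wr_zeta : hom (wr_s · wr_s) (wr_s · wr_t) := em_cell (mmul X).
Definition wr_sigma : hom (id1 wr_cell0) (wr_s · wr_t) := em_cell (munit X).

End Wreath.

Section EMCells.
Variable K : twocat.

Lemma em_cell_meq (T R : monad K) (F G F' G' : hcat (t := EM K) T R)
    (a : hom F G) (b : hom F' G') : a ≡ b -> em_cell a ≡ em_cell b.
Proof. by case. Qed.

Variables (A B : K).

Lemma em_idW (T R : monad K) (F : hcat (t := EM K) T R) (f : hcat (mob R) B)
    (g : hcat A (mob T)) :
  W f (em_cell (Id F)) g = W (f · em_car F) (munit T) g.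
Proof. by rewrite /= W_cast W_l. Qed.

Lemma em_castW (T R : monad K) (F G F' G' : hcat (t := EM K) T R) (a : hom F G)
    (e : streq F' F) (e' : streq G G') (f : hcat (mob R) B) (g : hcat A (mob T)) :
  W f (em_cell (cast (x' := F') (y' := G') a)) g = W f (em_cell a) g.
Proof.
case: _ / e' ; move: a; case: F / e => a.
by rewrite /cast /idc comp1m compm1.
Qed.

Lemma em_vcompW (T R : monad K) (F G G' H : hcat (t := EM K) T R)
    (b : hom G' H) (a : hom F G) (e : streq G G') (f : hcat (mob R) B)
    (g : hcat A (mob T)) :
  W f (em_cell (b ∙ a)) g =
  W (f · em_car H) (mmul T) g ** W f (em_cell b) (mcar T · g) ** W f (em_cell a) g.
Proof.
case: _ / e b => b; rewrite /vcomp /idc comp1m /=.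
by wn.
Qed.

Lemma em_whiskerlW (S T R : monad K) (F F' : hcat (t := EM K) S T)
    (a : hom F F') (G : hcat (t := EM K) T R) (f : hcat (mob R) B)
    (g : hcat A (mob S)) :
  W f (em_cell (Id G ⊙ a)) g = W (f · em_car G) (em_cell a) g.
Proof.
rewrite /=; wn.
use (psi_unitW (f · em_car G) g F).
use (Wx (f · em_car G) (id1 _) (em_cell a) (munit S) g).
use (mmulm1W (T := S) (f · (em_car G · em_car F')) g).
by unit_rules.
Qed.

Lemma em_whiskerrW (S T R : monad K) (G G' : hcat (t := EM K) T R)
    (b : hom G G') (F : hcat (t := EM K) S T) (f : hcat (mob R) B)
    (g : hcat A (mob S)) :
  W f (em_cell (b ⊙ Id F)) g =
  W (f · em_car G') (em_psi F) g ** W f (em_cell b) (em_car F · g).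
Proof.
rewrite /=; wn.
use (mmul1mW (T := S) (f · (em_car G' · em_car F)) g).
by unit_rules.
Qed.

End EMCells.

Section WreathProduct.
Variables (K : twocat) (X : wreath K).

Local Notation A := (wr_cell0 X).
Local Notation t := (wr_t X).
Local Notation μ := (wr_mu X).
Local Notation η := (wr_eta X).
Local Notation s := (wr_s X).
Local Notation ψ := (wr_psi X).
Local Notation ζ := (wr_zeta X).
Local Notation σ := (wr_sigma X).
Local Notation i1 := (id1 _).

Section Rules.
Variables (B C : K) (f : hcat A C) (g : hcat B A).

Lemma wr_mulAW : W f μ g ** W f μ (t · g) = W f μ g ** W (f · t) μ g.
Proof. exact: mmulAW. Qed.

Lemma wr_psi_mulW :
  W (f · s) μ g ** W f ψ (t · g) ** W (f · t) ψ g = W f ψ g ** W f μ (s · g).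
Proof. exact: psi_mulW. Qed.

Lemma wr_psi_unitW : W f ψ g ** W f η (s · g) = W (f · s) η g.
Proof. exact: psi_unitW. Qed.

Lemma wr_sigmaW :
  W (f · s) μ g ** W f ψ (t · g) ** W (f · t) σ g =
  W (f · s) μ g ** W f σ (t · g).
Proof.
have := cellW f g (munit X : em2 (em1_id (wr_base X)) (wr_em1 X)).
rewrite /=; wn; s1 => <-; unit_rules.
Qed.

Lemma wr_zetaW :
  W (f · s) μ g ** W f ψ (t · g) ** W (f · t) ζ g =
  W (f · s) μ g ** W f ζ (t · g) ** W (f · s) ψ g ** W f ψ (s · g).
Proof.
have := cellW f g (mmul X : em2 (em1_comp (wr_em1 X) (wr_em1 X)) (wr_em1 X)).
by rewrite /=; wn; s1 => <-.
Qed.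

Lemma wr_zetaAW :
  W (f · s) μ g ** W f ζ (t · g) ** W (f · s) ζ g =
  W (f · s) μ g ** W f ζ (t · g) ** W (f · s) ψ g ** W f ζ (s · g).
Proof.
have := W_meq f g (em_cell_meq (mmulA X)).
rewrite !em_vcompW em_whiskerlW em_whiskerrW; exact: esym.
Qed.

Lemma wr_zeta1mW :
  W (f · s) μ g ** W f ζ (t · g) ** W (f · s) ψ g ** W f σ (s · g) =
  W (f · s) η g.
Proof.
have := W_meq f g (em_cell_meq (mmul1m X)).
by rewrite !em_vcompW em_whiskerrW em_idW.
Qed.

Lemma wr_zetam1W :
  W (f · s) μ g ** W f ζ (t · g) ** W (f · s) σ g = W (f · s) η g.
Proof.
have := W_meq f g (em_cell_meq (mmulm1 X)).
by rewrite !em_vcompW em_whiskerlW em_idW.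
Qed.

End Rules.

Definition wr_prod_mul : hom (s · t · (s · t)) (s · t) :=
  ⟨(Id s ⊙ μ) ∙ (ζ ⊙ Id t) ∙ (Id s ⊙ Id s ⊙ μ) ∙ (Id s ⊙ ψ ⊙ Id t)⟩.

Lemma wr_prod_mulA :
  wr_prod_mul ∙ (wr_prod_mul ⊙ Id (s · t))
    ≡ wr_prod_mul ∙ (Id (s · t) ⊙ wr_prod_mul).
Proof.
rewrite /wr_prod_mul.
wstart.
set R := RHS.
use (esym (wr_psi_mulW s t)).
use (wr_mulAW (s · s) i1).
use (esym (Wx s i1 ψ μ i1)).
use (esym (Wx i1 i1 ζ ψ t)).
use (esym (Wx i1 s ζ μ i1)).
rewrite /R {R}; apply: esym; set L := RHS.
use (Wx s i1 ψ μ i1).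
use (esym (wr_mulAW (s · s) i1)).
use (wr_zetaW s t).
use (wr_mulAW (s · s) i1).
use (esym (Wx s i1 ζ μ i1)).
use (Wx i1 i1 ζ μ i1).
use (esym (wr_mulAW s i1)).
use (wr_zetaAW i1 t).
use (Wx s s ψ μ i1).
use (Wx (s · s) i1 ψ μ i1).
use (esym (wr_mulAW (s · (s · s)) i1)).
use (Wx s i1 ψ ψ t).
use (wr_psi_mulW (s · s) t).
use (wr_mulAW s i1).
by use (esym (Wx i1 i1 ζ μ i1)).
Qed.

Lemma wr_prod_mul1m : wr_prod_mul ∙ (σ ⊙ Id (s · t)) ≡ Id (s · t).
Proof.
rewrite /wr_prod_mul.
wstart.
use (Wx i1 i1 ζ μ i1).
use (esym (wr_mulAW s i1)).
use (wr_zeta1mW i1 t).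
use (mmul1mW (T := wr_base X) s i1).
by [].
Qed.

Lemma wr_prod_mulm1 : wr_prod_mul ∙ (Id (s · t) ⊙ σ) ≡ Id (s · t).
Proof.
rewrite /wr_prod_mul.
wstart.
use (wr_sigmaW s i1).
use (Wx i1 i1 ζ μ i1).
use (esym (wr_mulAW s i1)).
use (wr_zetam1W i1 t).
use (mmul1mW (T := wr_base X) s i1).
by [].
Qed.

Definition wr_prod : monad K :=
  Monad wr_prod_mulA wr_prod_mul1m wr_prod_mulm1.

Definition wr_iota : hom t (s · t) := ⟨(Id s ⊙ μ) ∙ (σ ⊙ Id t)⟩.

Lemma wr_iota_mul : wr_iota ∙ μ ≡ wr_prod_mul ∙ (wr_iota ⊙ wr_iota).
Proof.
rewrite /wr_iota /wr_prod_mul.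
wstart.
apply: esym; set L := RHS.
use (esym (wr_psi_mulW s t)).
use (esym (Wx i1 i1 σ ψ t)).
use (Wx i1 i1 ψ μ i1).
use (Wx i1 (s · t) σ μ i1).
use (Wx s t ψ μ i1).
use (Wx (s · s) i1 μ μ i1).
use (esym (wr_mulAW (s · s) i1)).
use (Wx i1 i1 ζ μ i1).
use (esym (wr_mulAW s i1)).
use (Wx i1 i1 ζ μ t).
use (esym (wr_mulAW s t)).
use (Wx i1 i1 ζ μ (t · t)).
use (esym (wr_mulAW s (t · t))).
use (wr_zeta1mW i1 (t · (t · t))).
use (mmul1mW (T := wr_base X) s (t · t)).
unit_rules.
use (wr_sigmaW i1 t).
use (wr_mulAW s i1).
by use (esym (Wx i1 i1 σ μ i1)).
Qed.

Lemma wr_iota_unit : wr_iota ∙ η ≡ σ.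
Proof.
rewrite /wr_iota.
wstart.
use (Wx i1 i1 σ η i1).
use (mmulm1W (T := wr_base X) s i1).
by unit_rules.
Qed.

End WreathProduct.

Section MonadAlgebra.
Variables (K : twocat) (T : monad K).

Let mul1 := meq_pk (mmul1m T).
Let mul2 := meq_pk (mmulm1 T).
Let mulA := meq_pk (mmulA T).

Definition monad_algebra : algebra (hom_moncat (mob T)).
Proof.
refine (@Algebra (hom_moncat (mob T)) (mcar T) (mmul T) (munit T) _ _ _).
- abstract (by apply: pk_meq; move: mulA; rewrite !pk_vcomp).
- abstract (by apply: pk_meq; move: mul1; rewrite !pk_vcomp).
- abstract (by apply: pk_meq; move: mul2; rewrite !pk_vcomp).
Defined.

Definition monad_rev_algebra : algebra (rev_moncat (hom_moncat (mob T))).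
Proof.
refine (@Algebra (rev_moncat (hom_moncat (mob T))) (mcar T) (mmul T) (munit T)
  _ _ _).
- abstract (by apply: pk_meq; move: (esym mulA); rewrite !pk_vcomp).
- abstract (by apply: pk_meq; move: mul2; rewrite !pk_vcomp).
- abstract (by apply: pk_meq; move: mul1; rewrite !pk_vcomp).
Defined.

End MonadAlgebra.

(* [EM(K)(𝔸)], whose tensor product is [X ⊗ Y = YX]. *)
Definition EM_moncat (K : twocat) (T : monad K) : moncat :=
  rev_moncat (hom_moncat (T : EM K)).

Definition wr_algebra (K : twocat) (X : wreath K) : algebra (EM_moncat (wr_base X)) :=
  monad_rev_algebra X.

Definition wr_extension (K : twocat) (X : wreath K) :
  alg_hom (monad_algebra (wr_base X)) (monad_algebra (wr_prod X)).
Proof.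
refine (@AlgHom (hom_moncat (wr_cell0 X)) (monad_algebra (wr_base X))
  (monad_algebra (wr_prod X)) (wr_iota X) _ _).
- abstract (by apply: pk_meq; have := meq_pk (wr_iota_mul X); rewrite !pk_vcomp).
- abstract (by apply: pk_meq; have := meq_pk (wr_iota_unit X); rewrite !pk_vcomp).
Defined.

(* Main.v *)
(* Conditions (i)-(v) are the standard characterizations of a Frobenius algebra,
   valid for a monad in any 2-category and here applied in [EM(K)]: from [(ϑ, e)]
   one gets the comultiplication [δ = (m ⊙ 1)(1 ⊙ e) = (1 ⊙ m)(e ⊙ 1)], from
   [(δ, ε)] the adjunction [(δ u, ε m)], and an associative [λ] equals [ϑ m] with
   [ϑ = λ(1 ⊙ u)].

   For (vi), [st] is free as a right [t]-module, so [st ⊗_t st] is a split quotient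
   of [stst], isomorphic to [sst].  A [t]-bimodule map [st -> t] is then the same as
   a 2-cell [s -> t] of [EM(K)], through [θ = μ(ϑ ⊙ t)] and [ϑ = θ(s ⊙ η)], and an
   [st]-central element of [st ⊗_t st] is the same as a cell [1 -> sst] that is
   central for [t] (a 2-cell of [EM(K)]) and for [s] (the Frobenius equation). *)
Require Import Defs.
From Stdlib Require Import ssreflect ssrfun ssrbool.

Set Implicit Arguments.
Unset Strict Implicit.
Unset Printing Implicit Defensive.

Local Notation "q ** p" := (acomp q p) (at level 41, right associativity).
Local Notation i1 := (id1 _).

(** * Frobenius monads in an arbitrary 2-category *)

Section FrobeniusMonad.
Variables (K : twocat) (T : monad K).

Local Notation t := (mcar T).
Local Notation m := (mmul T).
Local Notation u := (munit T).
Local Notation M := (rev_moncat (hom_moncat (mob T))).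

(** Reversing the tensor product exchanges the two sides of the Frobenius equation and the two
    counit conditions, so the same pair [(theta, e)] serves on both sides. *)
Lemma frobenius_rev_algebra :
  frobenius_monad T <-> frobenius_algebra (monad_rev_algebra T).
Proof.
split=> -[theta [e [/meq_pk h1 /meq_pk h2 /meq_pk h3]]]; exists theta, e;
  move: h1 h2 h3; rewrite !pk_vcomp => h1 h2 h3;
  split; apply: pk_meq; rewrite !pk_vcomp;
  first [exact: esym h1 | exact: h3 | exact: h2].
Qed.

(** Each of the two expressions of [d] through [e] makes one kind of linearity an instance of
    associativity: [dl] for the right one, [dr] for the left one. For each counit law the expression
    is chosen in which [theta] cancels directly against a leg of [e]. *)
Lemma frobenius_bilinear_coalgebra : frobenius_monad T ->
  exists C : coalgebra_on (M := M) t,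
    let δ : hom t (t · t) := comul C in
    δ ∙ m ≡ (Id t ⊙ m) ∙ (δ ⊙ Id t) /\
    (Id t ⊙ m) ∙ (δ ⊙ Id t) ≡ (m ⊙ Id t) ∙ (Id t ⊙ δ).
Proof.
case=> theta [e [h1 h2 h3]].
have fr B C (f : hcat _ B) (g : hcat C _) :
    W (f · t) m g ** W f e (t · g) = W f m (t · g) ** W (f · t) e g.
  by have := W_meq f g h1; wn.
have th_l B C (f : hcat _ B) (g : hcat C _) :
    W f theta (t · g) ** W f e g = W f u g.
  by have := W_meq f g h2; wn.
have th_r B C (f : hcat _ B) (g : hcat C _) :
    W (f · t) theta g ** W f e g = W f u g.
  by have := W_meq f g h3; wn.
have [d dl] : exists d : hom t (t · t), forall B C (f : hcat _ B) (g : hcat C _),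
    W f d g = W (f · t) m g ** W f e (t · g).
  by exists ⟨(Id t ⊙ m) ∙ (e ⊙ Id t)⟩ => B C f g; wn.
have dr B C (f : hcat _ B) (g : hcat C _) :
    W f d g = W f m (t · g) ** W (f · t) e g.
  by rewrite dl fr.
(* Expanding one factor of each composite with [dl] and the other with [dr]
   brings both sides to [(1 ⊙ m ⊙ 1)(1 ⊙ m ⊙ 1 ⊙ 1)(e ⊙ 1 ⊙ e)]. *)
have dA : (Id t ⊙ d) ∙ d ≡ (d ⊙ Id t) ∙ d.
  wstart.
  set R := RHS.
  use (dr _ _ t i1); use (dl _ _ i1 i1).
  use (esym (Wx t i1 m e i1)).
  use (esym (Wx i1 t e e i1)).
  use (mmulAW (T := T) t t).
  rewrite /R {R}; apply: esym; set L := RHS.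
  use (dl _ _ i1 t); use (dr _ _ i1 i1).
  by use (Wx i1 i1 e m t).
have ul : (Id t ⊙ theta) ∙ d ≡ Id t.
  wstart.
  use (dr _ _ i1 i1).
  use (esym (Wx i1 i1 m theta i1)).
  use (th_r _ _ t i1).
  by use (mmulm1W (T := T) i1 i1).
have ur : (theta ⊙ Id t) ∙ d ≡ Id t.
  wstart.
  use (dl _ _ i1 i1).
  use (Wx i1 i1 theta m i1).
  use (th_l _ _ i1 t).
  by use (mmul1mW (T := T) i1 i1).
have bl : d ∙ m ≡ (Id t ⊙ m) ∙ (d ⊙ Id t).
  wstart.
  use (dl _ _ i1 i1).
  use (Wx i1 i1 e m i1).
  use (esym (mmulAW (T := T) t i1)).
  by use (esym (dl _ _ i1 t)).
have br : d ∙ m ≡ (m ⊙ Id t) ∙ (Id t ⊙ d).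
  wstart.
  use (dr _ _ i1 i1).
  use (esym (Wx i1 i1 m e i1)).
  use (mmulAW (T := T) i1 t).
  by use (esym (dr _ _ t i1)).
have := meq_pk dA; have := meq_pk ul; have := meq_pk ur.
rewrite !pk_vcomp => pur pul pdA.
unshelve eexists.
  by exists d theta; apply: pk_meq; rewrite !pk_vcomp.
split=> //; apply: pk_meq; rewrite -(meq_pk bl); exact/meq_pk.
Qed.

(** In each triangle identity one half of bilinearity turns the composite into [d] after [m]; a unit
    law removes [m], and a counit law removes [d]. *)
Lemma associative_self_adjunction (C : coalgebra_on (M := M) t) :
  let δ : hom t (t · t) := comul C in
  δ ∙ m ≡ (Id t ⊙ m) ∙ (δ ⊙ Id t) ->
  (Id t ⊙ m) ∙ (δ ⊙ Id t) ≡ (m ⊙ Id t) ∙ (Id t ⊙ δ) ->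
  exists (rho : hom i1 (t · t)) (lambda : hom (t · t) i1),
    adjunction (M := M) (Y := t) (X := t) rho lambda /\
    lambda ∙ (m ⊙ Id t) ≡ lambda ∙ (Id t ⊙ m).
Proof.
case: C => d eps /= dA ul ur h1 h2.
have bl B C (f : hcat _ B) (g : hcat C _) :
    W (f · t) m g ** W f d (t · g) = W f d g ** W f m g.
  by have := W_meq f g h1; wn.
have br B C (f : hcat _ B) (g : hcat C _) :
    W f m (t · g) ** W (f · t) d g = W f d g ** W f m g.
  by have := W_meq f g h2; wn; rewrite bl.
have {}ul : pk (Id t ⊙ eps) ** pk d = pk (Id t).
  by have := meq_pk ul; rewrite !pk_vcomp.
have {}ur : pk (eps ⊙ Id t) ** pk d = pk (Id t).
  by have := meq_pk ur; rewrite !pk_vcomp.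
move: ul ur; rewrite -!W1; wn => ul ur.
exists (d ∙ u), (eps ∙ m).
split; [split|].
- apply: pk_meq; rewrite !pk_vcomp /= -!W1; wn.
  use (br _ _ i1 i1).
  use (mmulm1W (T := T) i1 i1).
  unit_rules; exact: ur.
- apply: pk_meq; rewrite !pk_vcomp /= -!W1; wn.
  use (bl _ _ i1 i1).
  use (mmul1mW (T := T) i1 i1).
  unit_rules; exact: ul.
- wstart; by use (mmulAW (T := T) i1 i1).
Qed.

Lemma associative_adjunction_form (lambda : hom (t · t) i1) :
  lambda ∙ (m ⊙ Id t) ≡ lambda ∙ (Id t ⊙ m) ->
  exists theta : hom t i1, lambda ≡ theta ∙ m.
Proof.
move=> h; exists ⟨lambda ∙ (Id t ⊙ u)⟩; apply: meq_sym.
have la B C (f : hcat _ B) (g : hcat C _) :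
    W f lambda g ** W f m (t · g) = W f lambda g ** W (f · t) m g.
  by have := W_meq f g h; wn.
wstart.
use (esym (Wx i1 i1 m u i1)).
use (la _ _ i1 i1).
use (mmulm1W (T := T) t i1).
by unit_rules.
Qed.

(** The pair [(theta, rho)] is itself the Frobenius system. Precomposing the triangle identities
    with [u] yields the two counit conditions. The Frobenius equation compares two ways of
    multiplying an input [t] placed between the inner legs of two copies of [rho], which agree by
    associativity of [m]. *)
Lemma frobenius_of_self_adjunction (rho : hom i1 (t · t)) (lambda : hom (t · t) i1)
    (theta : hom t i1) :
  adjunction (M := M) (Y := t) (X := t) rho lambda ->
  lambda ≡ theta ∙ m -> frobenius_monad T.
Proof.
case=> /meq_pk hr /meq_pk hl h.
rewrite !pk_vcomp in hr hl.
have {}hr : (lambda ⊙ Id t) ∙ (Id t ⊙ rho) ≡ Id t.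
  by apply: pk_meq; rewrite !pk_vcomp.
have {}hl : (Id t ⊙ lambda) ∙ (rho ⊙ Id t) ≡ Id t.
  by apply: pk_meq; rewrite !pk_vcomp.
have lE B C (f : hcat _ B) (g : hcat C _) :
    W f lambda g = W f theta g ** W f m g.
  by have := W_meq f g h; wn.
have hrW B C (f : hcat _ B) (g : hcat C _) :
    W f theta (t · g) ** W f m (t · g) ** W (f · t) rho g = aid (f · (t · g)).
  by have := W_meq f g hr; wn; rewrite lE; s1; rewrite -acompA.
have hlW B C (f : hcat _ B) (g : hcat C _) :
    W (f · t) theta g ** W (f · t) m g ** W f rho (t · g) = aid (f · (t · g)).
  by have := W_meq f g hl; wn; rewrite lE; s1; rewrite -acompA.
exists theta, rho; split.
- wstart.
  (* By the triangle identities the two sides of [key] are the two sides of the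
     Frobenius equation. *)
  have key :
    W t theta t ** W t m t ** W (t · t) rho i1 ** W t m i1 ** W i1 rho t =
    W t theta t ** W t m t ** W i1 rho (t · t) ** W i1 m t ** W t rho i1.
    use (esym (Wx t i1 m rho i1)).
    use (mmulAW (T := T) t t).
    use (esym (Wx i1 t rho rho i1)).
    by use (Wx i1 i1 rho m t).
  move: key; use (hrW _ _ t i1); use (hlW _ _ i1 t).
  by unit_rules.
- wstart.
  have := f_equal (fun p => p ** W i1 u i1) (hrW _ _ i1 i1); s1.
  unit_rules; rewrite -acompA => <-.
  use (esym (Wx i1 i1 u rho i1)).
  use (mmul1mW (T := T) i1 t).
  by unit_rules.
- wstart.
  have := f_equal (fun p => p ** W i1 u i1) (hlW _ _ i1 i1); s1.
  unit_rules; rewrite -acompA => <-.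
  use (Wx i1 i1 rho u i1).
  use (mmulm1W (T := T) t i1).
  by unit_rules.
Qed.

End FrobeniusMonad.

(** * Equations in [EM K] written as equations between 2-cells of [K] *)

Section WreathCells.
Variables (K : twocat) (X : wreath K).

Local Notation S := (wr_em1 X : hcat (t := EM K) (mob X) (mob X)).
Local Notation t := (wr_t X).
Local Notation μ := (wr_mu X).
Local Notation s := (wr_s X).
Local Notation ψ := (wr_psi X).
Local Notation ζ := (wr_zeta X).

Lemma em_meqP (T R : monad K) (F G F' G' : hcat (t := EM K) T R)
    (a : hom F G) (b : hom F' G') :
  F = F' -> G = G' -> a ≡ b <-> em_cell a ≡ em_cell b.
Proof. by move=> eF eG; split; [exact: em_cell_meq | exact: em2_meq]. Qed.

(** A vertical composite in [EM K] inserts one [μ], whiskering by [S] on the right inserts one [ψ],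
    and whiskering on the left inserts nothing. Expanding each composite by these rules produces the
    displayed formulas. *)
Lemma bilinear_cells (d : hom S (S · S)) :
  let δ : hom s (s · s · t) := em_cell d in
  (d ∙ mmul X ≡ (Id S ⊙ mmul X) ∙ (d ⊙ Id S) /\
   (Id S ⊙ mmul X) ∙ (d ⊙ Id S) ≡ (mmul X ⊙ Id S) ∙ (Id S ⊙ d)) <->
  ((Id s ⊙ Id s ⊙ μ) ∙ (δ ⊙ Id t) ∙ ζ
      ≡ (Id s ⊙ Id s ⊙ μ) ∙ (Id s ⊙ ζ ⊙ Id t) ∙ (Id s ⊙ Id s ⊙ ψ)
          ∙ (δ ⊙ Id s) /\
    (Id s ⊙ Id s ⊙ μ) ∙ (Id s ⊙ ζ ⊙ Id t) ∙ (Id s ⊙ Id s ⊙ ψ) ∙ (δ ⊙ Id s)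
      ≡ (Id s ⊙ Id s ⊙ μ) ∙ (Id s ⊙ ψ ⊙ Id t) ∙ (ζ ⊙ Id s ⊙ Id t)
          ∙ (Id s ⊙ δ)).
Proof.
move=> δ.
have e1 : pk (em_cell (d ∙ mmul X)) = pk ((Id s ⊙ Id s ⊙ μ) ∙ (δ ⊙ Id t) ∙ ζ).
  by rewrite -[LHS]W1 -[RHS]W1 em_vcompW; wn.
have e2 : pk (em_cell ((Id S ⊙ mmul X) ∙ (d ⊙ Id S))) =
   pk ((Id s ⊙ Id s ⊙ μ) ∙ (Id s ⊙ ζ ⊙ Id t) ∙ (Id s ⊙ Id s ⊙ ψ) ∙ (δ ⊙ Id s)).
  by rewrite -[LHS]W1 -[RHS]W1 em_vcompW em_whiskerlW em_whiskerrW; wn.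
have e3 : pk (em_cell ((mmul X ⊙ Id S) ∙ (Id S ⊙ d))) =
   pk ((Id s ⊙ Id s ⊙ μ) ∙ (Id s ⊙ ψ ⊙ Id t) ∙ (ζ ⊙ Id s ⊙ Id t) ∙ (Id s ⊙ δ)).
  by rewrite -[LHS]W1 -[RHS]W1 em_vcompW em_whiskerlW em_whiskerrW; wn.
rewrite !em_meqP; try exact: comp1A; try done.
split=> -[/meq_pk h1 /meq_pk h2]; split; apply: pk_meq; congruence.
Qed.

Lemma associative_cells (l : hom (S · S) (id1 (mob X))) :
  let λ : hom (s · s) (id1 (wr_cell0 X) · t) := em_cell l in
  l ∙ (mmul X ⊙ Id S) ≡ l ∙ (Id S ⊙ mmul X) <->
  μ ∙ (λ ⊙ Id t) ∙ (Id s ⊙ ψ) ∙ (ζ ⊙ Id s) ≡ μ ∙ (λ ⊙ Id t) ∙ (Id s ⊙ ζ).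
Proof.
move=> λ.
have e1 : pk (em_cell (l ∙ (mmul X ⊙ Id S))) =
    pk (μ ∙ (λ ⊙ Id t) ∙ (Id s ⊙ ψ) ∙ (ζ ⊙ Id s)).
  by rewrite -[LHS]W1 -[RHS]W1 em_vcompW em_whiskerrW; wn.
have e2 : pk (em_cell (l ∙ (Id S ⊙ mmul X))) = pk (μ ∙ (λ ⊙ Id t) ∙ (Id s ⊙ ζ)).
  by rewrite -[LHS]W1 -[RHS]W1 em_vcompW em_whiskerlW; wn.
rewrite !em_meqP; try exact: comp1AV; try done.
split=> /meq_pk h; apply: pk_meq; congruence.
Qed.

(* A 2-cell [ϑ] of [K] with [λ = μ(ϑ ⊙ 1)ζ] is automatically a 2-cell of
   [EM(K)], because it equals [λ(1 ⊙ σ)] there. *)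
Lemma form_cells (l : hom (S · S) (id1 (mob X))) :
  (exists theta : hom S (id1 (mob X)), l ≡ theta ∙ mmul X) <->
  exists ϑ : hom s t, em_cell l ≡ μ ∙ (ϑ ⊙ Id t) ∙ ζ.
Proof.
have e (theta : hom S (id1 (mob X))) (ϑ : hom s t) : pk (em_cell theta) = pk ϑ ->
   pk (em_cell (theta ∙ mmul X)) = pk (μ ∙ (ϑ ⊙ Id t) ∙ ζ).
  move=> h.
  rewrite -[LHS]W1 -[RHS]W1 em_vcompW; wn.
  by rewrite (W_meq _ _ (pk_meq h)).
split=> [[theta /em_cell_meq/meq_pk h]|[ϑ /meq_pk h]].
  have [ϑ hϑ] : exists ϑ : hom s t, pk (em_cell theta) = pk ϑ.
    by exists ⟨em_cell theta⟩; rewrite -[LHS]W1 -[RHS]W1; wn.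
  by exists ϑ; apply: pk_meq; rewrite h; apply: e.
exists ⟨l ∙ (Id S ⊙ munit X)⟩.
rewrite em_meqP //; apply: pk_meq; rewrite h; apply: esym; apply: e.
rewrite -[LHS]W1 -[RHS]W1 em_castW em_vcompW em_whiskerlW; wn.
have lE B C (f : hcat _ B) (g : hcat C _) : W f (em_cell l) g =
  W f μ g ** W f ϑ (t · g) ** W f ζ g.
  by have := W_meq f g (pk_meq h); wn.
use (lE _ _ i1 t).
use (wr_mulAW (X:=X) i1 i1).
use (esym (Wx i1 i1 ϑ μ i1)).
use (wr_zetam1W (X:=X) i1 i1).
use (Wx i1 i1 ϑ (wr_eta X) i1).
use (mmulm1W (T := wr_base X) i1 i1).
by unit_rules.
Qed.

End WreathCells.

(** * Coequalizers and relative tensor products, with composites of packed arrows *)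

Lemma coequalizer_desc (C : category) (x y q z : C) (f g : hom x y) (c : hom y q)
    (h : hom y z) :
  is_coequalizer f g c -> pk h ** pk f = pk h ** pk g ->
  exists k : hom q z, pk k ** pk c = pk h.
Proof.
case=> _ H; rewrite -!pk_comp => /pk_meq/meq_eq/H [k [<- _]].
by exists k; rewrite pk_comp.
Qed.

Lemma coequalizer_eq (C : category) (x y q : C) (f g : hom x y) (c : hom y q) :
  is_coequalizer f g c -> pk c ** pk f = pk c ** pk g.
Proof. by case=> e _; rewrite -!pk_comp e. Qed.

Lemma coequalizer_epi (C : category) (x y q z : C) (f g : hom x y) (c : hom y q)
    (k k' : hom q z) :
  is_coequalizer f g c -> pk k ** pk c = pk k' ** pk c -> k = k'.
Proof.
case=> e H; rewrite -!pk_comp => /pk_meq/meq_eq kk'.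
have /H [h [_ hU]] : Defs.comp (Defs.comp k c) f = Defs.comp (Defs.comp k c) g.
  by rewrite -!Defs.compA e.
by rewrite -(hU k) // -(hU k').
Qed.

Section RelativeTensor.
Variables (K : twocat) (U : K) (R : algebra (hom_moncat U)).
Variable Q : coequalizers (hom_moncat U).
Variables (X Y : hcat U U) (r : hom (X · (acar R : hcat U U)) X)
  (l : hom ((acar R : hcat U U) · Y) Y).

Local Notation XY := (rten (M := hom_moncat U) Q r l : hcat U U).
Local Notation q := (rten_map (M := hom_moncat U) Q r l : hom (X · Y) XY).

(** The parallel pair is described only up to [≡], which hides the cast in its second leg from later
    computations. *)
Lemma rten_mapP : exists f g : hom (X · (acar R : hcat U U) · Y) (X · Y),
  [/\ f ≡ r ⊙ Id Y, g ≡ Id X ⊙ l & is_coequalizer f g q].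
Proof.
do 2!eexists; split; last exact: coeqP; first by [].
apply: pk_meq; rewrite -[LHS](W1 (K := K)) -[RHS](W1 (K := K)) /=; wn.
by [].
Qed.

Lemma rten_mapW (B C : K) (f : hcat U C) (g : hcat B U) :
  W f q g ** W f r (Y · g) = W f q g ** W (f · X) l g.
Proof.
have [a [b [ha hb /coequalizer_eq]]] := rten_mapP.
rewrite (meq_pk ha) (meq_pk hb) => e.
have h : q ∙ (r ⊙ Id Y) ≡ q ∙ (Id X ⊙ l) by apply: pk_meq; rewrite !pk_vcomp.
by have := W_meq (K := K) f g h; wn.
Qed.

Lemma rten_desc (Z : hcat U U) (h : hom (X · Y) Z) :
  pk h ** W i1 r Y = pk h ** W X l i1 ->
  exists k : hom XY Z, k ∙ q ≡ h.
Proof.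
have [a [b [ha hb /coequalizer_desc H]]] := rten_mapP.
move=> e; have [] := H _ h.
  rewrite (meq_pk ha) (meq_pk hb) -[pk (r ⊙ _)](W1 (K := K))
   -[pk (_ ⊙ l)](W1 (K := K)); wn; exact: e.
by move=> k hk; exists k; apply: pk_meq; rewrite pk_vcomp.
Qed.

Lemma rten_epi (Z : hcat U U) (k k' : hom XY Z) :
  k ∙ q ≡ k' ∙ q -> k = k'.
Proof.
have [a [b [_ _ /coequalizer_epi H]]] := rten_mapP.
by move/meq_pk; rewrite !pk_vcomp; apply: H.
Qed.

(** Coflatness of [P] makes [Id P ⊙ q] a coequalizer again. This lemma and its mirror image produce
    the actions of [S] on [S ⊗_R S]. *)
Lemma coflat_desc_l (P Z : hcat U U) (h : hom (P · X · Y) Z) :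
  coflat (P : hom_moncat U) ->
  pk h ** W P r Y = pk h ** W (P · X) l i1 ->
  exists k : hom (P · XY) Z, k ∙ (Id P ⊙ q) ≡ h.
Proof.
have [a [b [ha hb H]]] := rten_mapP.
move=> /(_ _ _ _ _ _ _ H)[/coequalizer_desc {}H _] e.
(* Tensoring the coequalizer with [P] gives the bracketing [P · (X · Y)], which equals the source of
   [h] only propositionally. *)
have [h' hh'] : exists h' : hom (P · (X · Y)) Z, pk h' = pk h.
  by exists ⟨h⟩; rewrite -[LHS](W1 (K := K)) -[RHS](W1 (K := K)); wn.
have [] := H _ h'.
  rewrite hh' /= -[pk (_ ⊙ a)](W1 (K := K)) -[pk (_ ⊙ b)](W1 (K := K)); wn.
  by rewrite (W_meq (K := K) _ _ ha) (W_meq (K := K) _ _ hb); wn.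
by move=> k hk; exists k; apply: pk_meq; rewrite pk_vcomp -hh'.
Qed.

Lemma coflat_desc_r (P Z : hcat U U) (h : hom (X · Y · P) Z) :
  coflat (P : hom_moncat U) ->
  pk h ** W i1 r (Y · P) = pk h ** W X l P ->
  exists k : hom (XY · P) Z, k ∙ (q ⊙ Id P) ≡ h.
Proof.
have [a [b [ha hb H]]] := rten_mapP.
move=> /(_ _ _ _ _ _ _ H)[_ /coequalizer_desc {}H] e.
have [] := H _ h.
  rewrite /= -[pk (a ⊙ _)](W1 (K := K)) -[pk (b ⊙ _)](W1 (K := K)); wn.
  by rewrite (W_meq (K := K) _ _ ha) (W_meq (K := K) _ _ hb); wn.
by move=> k hk; exists k; apply: pk_meq; rewrite pk_vcomp.
Qed.

End RelativeTensor.

(** * Frobenius extensions whose central element is represented in [S ⊗ S] *)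

Section Extension.
Variables (K : twocat) (U : K) (R S : algebra (hom_moncat U)) (i : alg_hom R S).
Variable Q : coequalizers (hom_moncat U).

Local Notation r := (acar R : hcat U U).
Local Notation s := (acar S : hcat U U).
Local Notation mR := (amul R : hom (r · r) r).
Local Notation mS := (amul S : hom (s · s) s).
Local Notation ra := (ext_ract i : hom (s · r) s).
Local Notation la := (ext_lact i : hom (r · s) s).
Local Notation q := (rten_map Q ra la : hom (s · s) (rten Q ra la : hcat U U)).

(* A Frobenius system for the extension whose element [q ∙ e] of [S ⊗_R S] is
   represented by [e : 1 -> S ⊗ S]; in particular the conditions on [q ∙ e] need
   no maps defined on [S ⊗_R S]. *)
Definition frobenius_lift (theta : hom s r) (e : hom i1 (s · s)) : Prop :=
  [/\ ext_bimodule_hom i theta,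
      q ∙ (mS ⊙ Id s) ∙ (Id s ⊙ e) ≡ q ∙ (Id s ⊙ mS) ∙ (e ⊙ Id s),
      ra ∙ (Id s ⊙ theta) ∙ e ≡ aone S
    & la ∙ (theta ⊙ Id s) ∙ e ≡ aone S].

Section Rules.
Variables (B C : K) (f : hcat U C) (g : hcat B U).

Lemma amulAW : W f mS g ** W f mS (s · g) = W f mS g ** W (f · s) mS g.
Proof. by have := W_meq (K := K) f g (amulA S); rewrite /=; wn. Qed.

Lemma ahom_mulW :
  W f (i : hom r s) g ** W f mR g =
  W f mS g ** W f (i : hom r s) (s · g) ** W (f · r) (i : hom r s) g.
Proof. by have := W_meq (K := K) f g (ahom_mul i); rewrite /=; wn. Qed.

Lemma ext_lactW : W f la g = W f mS g ** W f (i : hom r s) (s · g).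
Proof. by rewrite /ext_lact /=; wn. Qed.

Lemma ext_ractW : W f ra g = W f mS g ** W (f · s) (i : hom r s) g.
Proof. by rewrite /ext_ract /=; wn. Qed.

End Rules.

Lemma ext_ract_assocW (B C : K) (f : hcat U C) (g : hcat B U) :
  W f ra g ** W f ra (r · g) = W f ra g ** W (f · s) mR g.
Proof.
rewrite !ext_ractW; s1.
use (ahom_mulW (f · s) g).
use (esym (Wx f i1 mS (i : hom r s) g)).
use (Wx (f · s) i1 (i : hom r s) (i : hom r s) g).
by use (amulAW f g).
Qed.

Lemma ext_lact_assocW (B C : K) (f : hcat U C) (g : hcat B U) :
  W f la g ** W f mR (s · g) = W f la g ** W (f · r) la g.
Proof.
rewrite !ext_lactW; s1.
use (ahom_mulW f (s · g)).
use (Wx f i1 (i : hom r s) mS g).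
by use (esym (amulAW f g)).
Qed.

Lemma ext_ract_mulW (B C : K) (f : hcat U C) (g : hcat B U) :
  W f mS g ** W (f · s) ra g = W f ra g ** W f mS (r · g).
Proof.
rewrite !ext_ractW; s1; rewrite -?acompA.
use (esym (Wx f i1 mS (i : hom r s) g)).
by use (amulAW f g).
Qed.

Lemma ext_lact_mulW (B C : K) (f : hcat U C) (g : hcat B U) :
  W f mS g ** W f la (s · g) = W f la g ** W (f · r) mS g.
Proof.
rewrite !ext_lactW; s1; rewrite -?acompA.
use (amulAW f g).
by use (Wx f i1 (i : hom r s) mS g).
Qed.

(** Every map demanded by the definition is a factorization through a quotient. [muS] and [nuS] come
    from coflatness and the linearity of [mS] over [R], [Ups] and [Ups'] from associativity of the
    actions, [tht] and [thh] from the left and right linearity of [theta]. On [qSS ∙ e] these maps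
    are computed by their values on [e]. *)
Lemma frobenius_extension_lift (theta : hom s r) (e : hom i1 (s · s)) :
  coflat (acar S) -> frobenius_lift theta e -> frobenius_extension Q i.
Proof.
move=> fS [].
(* [ext_ract] and [ext_lact] are generalized because [wn] would unfold them. *)
have actr := ext_ract_assocW; have actl := ext_lact_assocW.
have linr := ext_ract_mulW; have linl := ext_lact_mulW.
rewrite /frobenius_extension /ext_bimodule_hom.
move: (ext_ract i) (ext_lact i) actr actl linr linl => rS lS actr actl linr linl.
move=> [th_l th_r] fr h1 h2.
have th_lW (B C : K) (f : hcat U C) (g : hcat B U) :
    W f theta g ** W f lS g = W f mR g ** W (f · r) theta g.
  by have := W_meq (K := K) f g th_l; rewrite /=; wn.
have th_rW (B C : K) (f : hcat U C) (g : hcat B U) :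
    W f theta g ** W f rS g = W f mR g ** W f theta (r · g).
  by have := W_meq (K := K) f g th_r; rewrite /=; wn.
pose qSS : hom (s · s) (rten Q rS lS : hcat U U) := rten_map Q rS lS.
pose SS : hcat U U := rten Q rS lS.
pose SR : hcat U U := rten Q rS mR.
pose RS : hcat U U := rten Q mR lS.
pose qSR : hom (s · r) SR := rten_map Q rS mR.
pose qRS : hom (r · s) RS := rten_map Q mR lS.
have [muS hmu] : exists muS : hom (s · SS) SS, muS ∙ (Id s ⊙ qSS) ≡ qSS ∙ (mS ⊙ Id s).
  have [h hh] : exists h : hom (s · s · s) SS, h ≡ qSS ∙ (mS ⊙ Id s).
    by eexists.
  have [|k hk] := coflat_desc_l Q (r := rS) (l := lS) (h := h) fS.
    rewrite (meq_pk hh) -[pk _](W1 (K := K)); wn.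
    use (linr _ _ i1 s).
    use (rten_mapW Q rS lS i1 i1).
    by use (esym (Wx i1 i1 mS lS i1)).
  by exists k; apply: pk_meq; rewrite -(meq_pk hh); apply: meq_pk.
have [nuS hnu] : exists nuS : hom (SS · s) SS, nuS ∙ (qSS ⊙ Id s) ≡ qSS ∙ (Id s ⊙ mS).
  have [h hh] : exists h : hom (s · s · s) SS, h ≡ qSS ∙ (Id s ⊙ mS).
    by exists ⟨qSS ∙ (Id s ⊙ mS)⟩; wstart.
  have [|k hk] := coflat_desc_r Q (r := rS) (l := lS) (h := h) fS.
    rewrite (meq_pk hh) -[pk _](W1 (K := K)); wn.
    use (esym (Wx i1 i1 rS mS i1)).
    use (rten_mapW Q rS lS i1 i1).
    by use (esym (linl _ _ s i1)).
  by exists k; apply: pk_meq; rewrite -(meq_pk hh); apply: meq_pk.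
have [Ups hUps] : exists Ups : hom SR s, Ups ∙ qSR ≡ rS.
  apply: rten_desc; rewrite -[pk _](W1 (K := K)); have := actr _ _ i1 i1; s1; exact.
have [Ups' hUps'] : exists Ups' : hom RS s, Ups' ∙ qRS ≡ lS.
  apply: rten_desc; rewrite -[pk _](W1 (K := K)); have := actl _ _ i1 i1; s1; exact.
have [tht htht] : exists tht : hom SS SR, tht ∙ qSS ≡ qSR ∙ (Id s ⊙ theta).
  apply: rten_desc; rewrite -[pk _](W1 (K := K)); wn.
  use (esym (Wx i1 i1 rS theta i1)).
  use (rten_mapW Q rS mR i1 i1).
  by use (esym (th_lW _ _ s i1)).
have [thh hthh] : exists thh : hom SS RS, thh ∙ qSS ≡ qRS ∙ (theta ⊙ Id s).
  apply: rten_desc; rewrite -[pk _](W1 (K := K)); wn.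
  use (th_rW _ _ i1 s).
  use (rten_mapW Q mR lS i1 i1).
  by use (esym (Wx i1 i1 theta lS i1)).
exists muS, nuS, Ups, Ups'; split.
  by split; apply: pk_meq; rewrite !pk_vcomp;
   move: (meq_pk hmu) (meq_pk hnu) (meq_pk hUps) (meq_pk hUps'); rewrite !pk_vcomp.
have muW := W_meq (K := K) i1 i1 hmu.
have nuW := W_meq (K := K) i1 i1 hnu.
have UpsW := W_meq (K := K) i1 i1 hUps.
have UpsW' := W_meq (K := K) i1 i1 hUps'.
have thtW := W_meq (K := K) i1 i1 htht.
have thhW := W_meq (K := K) i1 i1 hthh.
have frW := W_meq (K := K) i1 i1 fr.
move: muW nuW UpsW UpsW' thtW thhW frW; wn => muW nuW UpsW UpsW' thtW thhW frW.
have c1 : muS ∙ (Id s ⊙ (qSS ∙ e)) ≡ nuS ∙ ((qSS ∙ e) ⊙ Id s).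
  by wstart; use muW; use nuW.
have c2 : Ups ∙ tht ∙ (qSS ∙ e) ≡ aone S.
  apply: pk_meq; rewrite -(meq_pk h1) -[LHS](W1 (K := K)) -[RHS](W1 (K := K)) /=; wn.
  by use thtW; use UpsW.
have c3 : Ups' ∙ thh ∙ (qSS ∙ e) ≡ aone S.
  apply: pk_meq; rewrite -(meq_pk h2) -[LHS](W1 (K := K)) -[RHS](W1 (K := K)) /=; wn.
  by use thhW; use UpsW'.
exists theta, tht, thh, (qSS ∙ e); split.
  by split.
split=> //; apply: pk_meq; move: (meq_pk c1); rewrite !pk_vcomp; exact.
Qed.

(** A section [c] of the quotient map supplies the representative [c ∙ e] of any
    [e : 1 -> S ⊗_R S]. *)
Lemma frobenius_extension_section (c : hom (rten Q ra la : hcat U U) (s · s)) :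
  q ∙ c ≡ Id (rten Q ra la) -> frobenius_extension Q i ->
  exists theta e, frobenius_lift theta e.
Proof.
rewrite /frobenius_extension /frobenius_lift.
move: (ext_bimodule_hom i) (ext_ract i) (ext_lact i) c => bim rS lS c hc.
pose qSS : hom (s · s) (rten Q rS lS : hcat U U) := rten_map Q rS lS.
pose SS : hcat U U := rten Q rS lS.
pose SR : hcat U U := rten Q rS mR.
pose RS : hcat U U := rten Q mR lS.
pose qSR : hom (s · r) SR := rten_map Q rS mR.
pose qRS : hom (r · s) RS := rten_map Q mR lS.
have cW (B C : K) (f : hcat U C) (g : hcat B U) :
    W f qSS g ** W f c g = aid (f · (SS · g)).
  by have := W_meq (K := K) f g hc; wn.
case=> muS [nuS [Ups [Ups' [[]]]]].
rewrite -/SS -/SR -/RS -/qSS -/qSR -/qRS /= => hmu hnu hUps hUps'.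
case=> theta [tht [thh [e [[bi htht hthh] [h1 h2 h3]]]]].
rewrite -/SS in e h1 h2 h3.
have muW := W_meq (K := K) i1 i1 hmu.
have nuW := W_meq (K := K) i1 i1 hnu.
have UpsW := W_meq (K := K) i1 i1 hUps.
have UpsW' := W_meq (K := K) i1 i1 hUps'.
have thtW := W_meq (K := K) i1 i1 htht.
have thhW := W_meq (K := K) i1 i1 hthh.
have frW := W_meq (K := K) i1 i1 h1.
move: muW nuW UpsW UpsW' thtW thhW frW; wn => muW nuW UpsW UpsW' thtW thhW frW.
exists theta, (c ∙ e); split=> //.
- wstart.
  use (esym muW); use (cW _ _ s i1).
  use (esym nuW); use (cW _ _ i1 s).
  unit_rules; by use frW.
- apply: pk_meq; rewrite -(meq_pk h2) -[LHS](W1 (K := K)) -[RHS](W1 (K := K)) /=; wn.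
  use (esym UpsW); use (esym thtW); use (cW _ _ i1 i1).
  by unit_rules.
- apply: pk_meq; rewrite -(meq_pk h3) -[LHS](W1 (K := K)) -[RHS](W1 (K := K)) /=; wn.
  use (esym UpsW'); use (esym thhW); use (cW _ _ i1 i1).
  by unit_rules.
Qed.

End Extension.

Lemma meq_iff (C : category) (x1 y1 x2 y2 x3 y3 x4 y4 : C)
    (a : hom x1 y1) (b : hom x2 y2) (a' : hom x3 y3) (b' : hom x4 y4) :
  pk a = pk a' -> pk b = pk b' -> a ≡ b <-> a' ≡ b'.
Proof. by move=> ea eb; split=> /meq_pk h; apply: pk_meq; congruence. Qed.

(** * Frobenius wreaths described by 2-cells of [K] *)

Section WreathExtension.
Variables (K : twocat) (X : wreath K).

Local Notation S := (wr_em1 X : hcat (t := EM K) (mob X) (mob X)).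
Local Notation t := (wr_t X).
Local Notation μ := (wr_mu X).
Local Notation s := (wr_s X).
Local Notation ψ := (wr_psi X).
Local Notation ζ := (wr_zeta X).
Local Notation σ := (wr_sigma X).

(* The first two equations say that [ϑ] and [e] are 2-cells of [EM(K)]; the other
   three are the axioms of a Frobenius monad in [EM(K)]. *)
Definition frobenius_cells (ϑ : hom s t) (e : hom i1 (s · (s · t))) : Prop :=
  [/\ μ ∙ (ϑ ⊙ Id t) ∙ ψ ≡ μ ∙ (Id t ⊙ ϑ),
      (Id s ⊙ Id s ⊙ μ) ∙ (e ⊙ Id t)
        ≡ (Id s ⊙ Id s ⊙ μ) ∙ (Id s ⊙ ψ ⊙ Id t) ∙ (ψ ⊙ Id s ⊙ Id t)
            ∙ (Id t ⊙ e),
      (Id s ⊙ Id s ⊙ μ) ∙ (Id s ⊙ ψ ⊙ Id t) ∙ (ζ ⊙ Id s ⊙ Id t) ∙ (Id s ⊙ e)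
        ≡ (Id s ⊙ Id s ⊙ μ) ∙ (Id s ⊙ ζ ⊙ Id t) ∙ (Id s ⊙ Id s ⊙ ψ)
            ∙ (e ⊙ Id s),
      (Id s ⊙ μ) ∙ (ψ ⊙ Id t) ∙ (ϑ ⊙ Id s ⊙ Id t) ∙ e ≡ σ
    & (Id s ⊙ μ) ∙ (Id s ⊙ ϑ ⊙ Id t) ∙ e ≡ σ].

(** The cells underlying [theta] and [e] end in [i1 · t] and [s · s · t], equal to the targets of
    [ϑ] and [e'] only by strictness. Hence [key] compares them as packed arrows. *)
Lemma frobenius_monad_cells :
  frobenius_monad X <-> exists ϑ e, frobenius_cells ϑ e.
Proof.
have key (theta : hom S (id1 (mob X))) (e : hom (id1 (mob X)) (S · S))
    (ϑ : hom s t) (e' : hom i1 (s · (s · t))) :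
    pk (em_cell theta) = pk ϑ -> pk (em_cell e) = pk e' ->
    [/\ (mmul X ⊙ Id S) ∙ (Id S ⊙ e) ≡ (Id S ⊙ mmul X) ∙ (e ⊙ Id S),
        (theta ⊙ Id S) ∙ e ≡ munit X & (Id S ⊙ theta) ∙ e ≡ munit X] <->
    frobenius_cells ϑ e'.
  move=> ht he.
  have htW A B (f : hcat _ B) (g : hcat A _) :
    W f (em_cell theta) g = W f ϑ g by apply: W_meq; exact: pk_meq.
  have heW A B (f : hcat _ B) (g : hcat A _) :
    W f (em_cell e) g = W f e' g by apply: W_meq; exact: pk_meq.
  have c1 : μ ∙ (ϑ ⊙ Id t) ∙ ψ ≡ μ ∙ (Id t ⊙ ϑ).
    wstart; have := cellW i1 i1 theta.
    rewrite /= htW; wn; rewrite !htW; s1; unit_rules; exact.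
  have c2 : (Id s ⊙ Id s ⊙ μ) ∙ (e' ⊙ Id t)
        ≡ (Id s ⊙ Id s ⊙ μ) ∙ (Id s ⊙ ψ ⊙ Id t) ∙ (ψ ⊙ Id s ⊙ Id t)
            ∙ (Id t ⊙ e').
    wstart; have := cellW i1 i1 e.
    rewrite /= heW; wn; rewrite !heW; s1; unit_rules; exact.
  have f1 : (mmul X ⊙ Id S) ∙ (Id S ⊙ e) ≡ (Id S ⊙ mmul X) ∙ (e ⊙ Id S) <->
    (Id s ⊙ Id s ⊙ μ) ∙ (Id s ⊙ ψ ⊙ Id t) ∙ (ζ ⊙ Id s ⊙ Id t) ∙ (Id s ⊙ e')
        ≡ (Id s ⊙ Id s ⊙ μ) ∙ (Id s ⊙ ζ ⊙ Id t) ∙ (Id s ⊙ Id s ⊙ ψ)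
            ∙ (e' ⊙ Id s).
    rewrite em_meqP; [by rewrite comp11f comp1f1|by []|].
    by apply: meq_iff; rewrite -[LHS]W1 -[RHS]W1 !em_vcompW ?em_whiskerrW ?em_whiskerlW
      ?heW; wn.
  have f2 : (theta ⊙ Id S) ∙ e ≡ munit X <->
      (Id s ⊙ μ) ∙ (ψ ⊙ Id t) ∙ (ϑ ⊙ Id s ⊙ Id t) ∙ e' ≡ σ.
    rewrite em_meqP; [by []|by rewrite comp11f|].
    by apply: meq_iff; rewrite -[LHS]W1 -[RHS]W1 ?em_vcompW ?em_whiskerrW ?em_whiskerlW
      ?heW ?htW; wn.
  have f3 : (Id S ⊙ theta) ∙ e ≡ munit X <->
      (Id s ⊙ μ) ∙ (Id s ⊙ ϑ ⊙ Id t) ∙ e' ≡ σ.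
    rewrite em_meqP; [by []|by rewrite comp1f1|].
    by apply: meq_iff; rewrite -[LHS]W1 -[RHS]W1 ?em_vcompW ?em_whiskerrW ?em_whiskerlW
      ?heW ?htW; wn.
  by split=> [[/f1 ? /f2 ? /f3 ?]|[_ _ /f1 ? /f2 ? /f3 ?]].
split=> [[theta [e H]]|[ϑ [e' H]]].
  have [ϑ hϑ] : exists ϑ : hom s t, pk (em_cell theta) = pk ϑ.
    by exists ⟨em_cell theta⟩; rewrite -[LHS]W1 -[RHS]W1; wn.
  have [e' he] : exists e' : hom i1 (s · (s · t)), pk (em_cell e) = pk e'.
    by exists ⟨em_cell e⟩; rewrite -[LHS]W1 -[RHS]W1; wn.
  by exists ϑ, e'; apply/(key _ _ _ _ hϑ he).
(* The first two equations are exactly what is required to promote [ϑ] and [e'] to 2-cells of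
   [EM K]. *)
have [T E _ _ _] := H.
have [theta hth] : exists theta : hom S (id1 (mob X)), pk (em_cell theta) = pk ϑ.
  unshelve eexists; first exists (⟨ϑ⟩ : hom s (i1 · t)).
    have := W_meq i1 i1 T; wn => {}T.
    by wstart; use T; unit_rules.
  by rewrite -[LHS]W1 -[RHS]W1 /=; wn.
have [e he] : exists e : hom (id1 (mob X)) (S · S), pk (em_cell e) = pk e'.
  unshelve eexists; first exists (⟨e'⟩ : hom i1 (s · s · t)).
    have := W_meq i1 i1 E; wn => {}E.
    by wstart; use E; unit_rules.
  by rewrite -[LHS]W1 -[RHS]W1 /=; wn.
by exists theta, e; apply/(key _ _ _ _ hth he).
Qed.

End WreathExtension.

(** * The actions of [t] and of [st] on the wreath product and on [sst] *)

Section LiftCells.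
Variables (K : twocat) (X : wreath K).

Local Notation U := (wr_cell0 X).
Local Notation t := (wr_t X).
Local Notation μ := (wr_mu X).
Local Notation η := (wr_eta X).
Local Notation s := (wr_s X).
Local Notation ψ := (wr_psi X).
Local Notation ζ := (wr_zeta X).
Local Notation σ := (wr_sigma X).
Local Notation m := (wr_prod_mul X).

Section Rules.
Variables (B C : K) (f : hcat U C) (g : hcat B U).

Lemma wr_prod_mulW : W f m g =
  W (f · s) μ g ** W f ζ (t · g) ** W (f · (s · s)) μ g ** W (f · s) ψ (t · g).
Proof. by rewrite /wr_prod_mul; wn. Qed.

(** The unit law [wr_zetam1W] cancels the [σ] of [ι] against [ζ], so that [t] acts on [st] from the
    right as on a free module. *)
Lemma wr_ractW :
  W f (ext_ract (wr_extension X) : hom (s · t · t) (s · t)) g = W (f · s) μ g.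
Proof.
rewrite /ext_ract /=.
rewrite W_vcomp W_l wr_prod_mulW /wr_iota; wn.
use (Wx (f · s) i1 ψ μ g).
use (esym (wr_mulAW (f · (s · s)) g)).
use (wr_sigmaW (f · s) (t · g)).
use (wr_mulAW (f · (s · s)) g).
use (esym (Wx (f · s) i1 σ μ g)).
use (Wx f i1 ζ μ g).
use (esym (wr_mulAW (f · s) g)).
use (wr_zetam1W f (t · g)).
use (mmul1mW (T := wr_base X) (f · s) g).
by unit_rules.
Qed.

(** Here [wr_zeta1mW] cancels [σ], after [ψ] has carried the acting [t] past [s]. *)
Lemma wr_lactW :
  W f (ext_lact (wr_extension X) : hom (t · (s · t)) (s · t)) g =
  W (f · s) μ g ** W f ψ (t · g).
Proof.
rewrite /ext_lact /=.
rewrite W_vcomp W_r wr_prod_mulW /wr_iota; wn.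
use (esym (wr_psi_mulW (f · s) (t · g))).
use (wr_mulAW (f · (s · s)) g).
use (esym (Wx f i1 σ ψ (t · g))).
use (esym (Wx (f · s) i1 ψ μ g)).
use (esym (Wx f s σ μ g)).
use (Wx f i1 ζ μ g).
use (esym (wr_mulAW (f · s) g)).
use (wr_zeta1mW f (t · g)).
use (mmul1mW (T := wr_base X) (f · s) g).
by unit_rules.
Qed.

End Rules.

(* Under the identification of [st ⊗_t st] with [sst], whose quotient map is
   [(ss ⊙ μ)(s ⊙ ψ ⊙ t)], the parenthesized factors below are the left and right
   multiplications by [st] on [sst]. *)
Lemma rten_mul_l :
  W (s · s) μ i1 ** W s ψ t ** W i1 m (s · t) =
  (W (s · s) μ i1 ** W s ψ t ** W i1 ζ (s · t) ** W (s · (s · s)) μ i1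
    ** W (s · s) ψ t ** W s ψ (s · t))
  ** W (s · (t · (s · s))) μ i1 ** W (s · (t · s)) ψ t.
Proof.
rewrite wr_prod_mulW; s1; rewrite -!acompA.
use (esym (wr_psi_mulW s t)).
use (wr_mulAW (s · s) i1).
use (esym (Wx i1 i1 ζ ψ t)).
use (esym (Wx s i1 ψ μ i1)).
use (esym (Wx i1 s ζ μ i1)).
set L := LHS.
use (Wx s s ψ μ i1).
use (Wx (s · s) i1 ψ μ i1).
use (esym (wr_mulAW (s · (s · s)) i1)).
use (Wx s i1 ψ ψ t).
by use (wr_psi_mulW (s · s) t).
Qed.

(** The [t] of the first factor has to cross the product of two copies of [s]; [wr_zetaW], the fact
    that [ζ] is a 2-cell of [EM K], allows this. *)
Lemma rten_mul_r :
  W (s · s) μ i1 ** W s ψ t ** W (s · t) m i1 =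
  (W (s · s) μ i1 ** W s ζ t ** W (s · (s · s)) μ i1 ** W (s · s) ψ t)
  ** W (s · s) μ (s · t) ** W s ψ (t · (s · t)).
Proof.
rewrite wr_prod_mulW; s1; rewrite -!acompA.
use (Wx s i1 ψ μ i1).
use (esym (wr_mulAW (s · s) i1)).
use (wr_zetaW s t).
use (wr_mulAW (s · s) i1).
use (esym (Wx s i1 ζ μ i1)).
set L := LHS.
use (esym (wr_psi_mulW (s · s) t)).
use (wr_mulAW (s · (s · s)) i1).
use (esym (Wx (s · s) i1 ψ μ i1)).
use (esym (Wx s i1 ψ ψ t)).
by use (esym (Wx s s ψ μ i1)).
Qed.

(* [e : 1 -> sst] is central for the bimodule actions of [st] if and only if it is
   central for those of [t] and of [s], to which one restricts along
   [ι = (s ⊙ μ)(σ ⊙ t)] and along [s ⊙ η : s -> st]. *)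
Lemma wr_prod_centralP (e : hom i1 (s · (s · t))) :
  W (s · s) μ i1 ** W s ψ t ** W i1 ζ (s · t) ** W (s · (s · s)) μ i1
    ** W (s · s) ψ t ** W s ψ (s · t) ** W (s · t) e i1 =
  W (s · s) μ i1 ** W s ζ t ** W (s · (s · s)) μ i1 ** W (s · s) ψ t
    ** W i1 e (s · t) <->
  ((Id s ⊙ Id s ⊙ μ) ∙ (e ⊙ Id t)
        ≡ (Id s ⊙ Id s ⊙ μ) ∙ (Id s ⊙ ψ ⊙ Id t) ∙ (ψ ⊙ Id s ⊙ Id t)
            ∙ (Id t ⊙ e) /\
      (Id s ⊙ Id s ⊙ μ) ∙ (Id s ⊙ ψ ⊙ Id t) ∙ (ζ ⊙ Id s ⊙ Id t) ∙ (Id s ⊙ e)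
        ≡ (Id s ⊙ Id s ⊙ μ) ∙ (Id s ⊙ ζ ⊙ Id t) ∙ (Id s ⊙ Id s ⊙ ψ)
            ∙ (e ⊙ Id s)).
Proof.
split=> [G|[cE cF]]; last first.
  have EW A B (f : hcat _ B) (g : hcat A _) :
      W (f · (s · s)) μ g ** W f e (t · g) =
      W (f · (s · s)) μ g ** W (f · s) ψ (t · g) ** W f ψ (s · (t · g))
        ** W (f · t) e g.
    by have := W_meq f g cE; wn.
  have FW A B (f : hcat _ B) (g : hcat A _) :
      W (f · (s · s)) μ g ** W (f · s) ψ (t · g) ** W f ζ (s · (t · g))
        ** W (f · s) e g =
      W (f · (s · s)) μ g ** W (f · s) ζ (t · g) ** W (f · (s · s)) ψ g
        ** W f e (s · g).
    by have := W_meq f g cF; wn.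
  (* The multiplication by [st] is moved across [e] in two stages, its [t] by [EW] and then its [s]
     by [FW]. *)
  use (esym (EW _ _ s i1)).
  use (Wx i1 s ζ μ i1).
  use (Wx s i1 ψ μ i1).
  use (esym (wr_mulAW (s · s) i1)).
  use (FW _ _ i1 t).
  use (wr_mulAW (s · s) i1).
  by use (esym (Wx s i1 ζ μ i1)).
split; wstart.
- apply: etrans
    (etrans _ (esym (f_equal (fun p => p ** W s μ i1 ** W i1 σ t) G))) _.
    rewrite -!acompA; apply: esym.
    use (Wx i1 s e μ i1).
    use (Wx i1 i1 e σ t).
    use (Wx (s · s) i1 ψ μ i1).
    use (esym (wr_mulAW (s · (s · s)) i1)).
    use (wr_sigmaW (s · s) t).
    use (wr_mulAW (s · (s · s)) i1).
    use (esym (Wx (s · s) i1 σ μ i1)).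
    use (Wx s i1 ζ μ i1).
    use (esym (wr_mulAW (s · s) i1)).
    use (wr_zetam1W s t).
    use (mmul1mW (T := wr_base X) (s · s) i1).
    by unit_rules.
  rewrite -!acompA.
  use (esym (Wx s i1 μ e i1)).
  use (esym (Wx i1 t σ e i1)).
  use (esym (wr_psi_mulW s (s · t))).
  use (esym (wr_psi_mulW (s · s) t)).
  use (wr_mulAW (s · (s · s)) i1).
  use (esym (Wx i1 i1 σ ψ (s · t))).
  use (esym (Wx s i1 ψ ψ t)).
  use (esym (Wx i1 s σ ψ t)).
  use (esym (Wx (s · s) i1 ψ μ i1)).
  use (esym (Wx s s ψ μ i1)).
  use (esym (Wx i1 (s · s) σ μ i1)).
  use (Wx i1 s ζ μ i1).
  use (Wx i1 i1 ζ ψ t).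
  use (Wx s i1 ψ μ i1).
  use (esym (wr_mulAW (s · s) i1)).
  use (wr_psi_mulW s t).
  use (wr_zeta1mW i1 (s · t)).
  use (wr_psi_unitW s t).
  use (mmul1mW (T := wr_base X) (s · s) i1).
  by unit_rules.
- apply: etrans (etrans _ (f_equal (fun p => p ** W s η i1) G)) _.
    rewrite -!acompA; apply: esym.
    use (esym (Wx s i1 η e i1)).
    use (wr_psi_unitW s (s · t)).
    use (wr_psi_unitW (s · s) t).
    use (mmul1mW (T := wr_base X) (s · (s · s)) i1).
    by unit_rules.
  rewrite -!acompA.
  use (Wx i1 s e η i1).
  use (Wx (s · s) i1 ψ η i1).
  use (mmulm1W (T := wr_base X) (s · (s · s)) i1).
  by unit_rules.
Qed.

End LiftCells.

(** * The quotient [st ⊗_t st] as [sst], and the comparison of Frobenius data *)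

Section WreathLift.
Variables (K : twocat) (X : wreath K).
Variable Q : coequalizers (hom_moncat (wr_cell0 X)).

Local Notation U := (wr_cell0 X).
Local Notation t := (wr_t X).
Local Notation μ := (wr_mu X).
Local Notation η := (wr_eta X).
Local Notation s := (wr_s X).
Local Notation ψ := (wr_psi X).
Local Notation ζ := (wr_zeta X).
Local Notation σ := (wr_sigma X).
Local Notation m := (wr_prod_mul X).
Local Notation R := (monad_algebra (wr_base X)).
Local Notation ra := (ext_ract (wr_extension X) : hom (s · t · t) (s · t)).
Local Notation la := (ext_lact (wr_extension X) : hom (t · (s · t)) (s · t)).
Local Notation SS := (rten (R := R) Q ra la : hcat U U).
Local Notation q := (rten_map (R := R) Q ra la : hom (s · t · (s · t)) SS).

(* [stst ⇉ st ⊗_t st] is a split coequalizer: [s ⊙ η ⊙ st] is the section. *)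
Lemma rten_splitW :
  W i1 q i1 ** W s η (s · t) ** W (s · s) μ i1 ** W s ψ t = W i1 q i1.
Proof.
have h := rten_mapW (R := R) Q ra la i1 i1.
rewrite wr_ractW wr_lactW in h.
have hq : W i1 q i1 ** aid (s · (t · (s · t))) = W i1 q i1.
  by rewrite Waidr // comp11f comp1f1 comp1A.
move: (W i1 q i1) h hq => a h hq.
have := f_equal (fun p => p ** W s η (t · (s · t))) h; s1; rewrite -!acompA.
use (mmul1mW (T := wr_base X) s (s · t)).
use (esym (Wx s i1 η ψ t)).
use (esym (Wx s s η μ i1)).
by rewrite hq.
Qed.

(** The map on the right is balanced over [t] because [ψ] is multiplicative, so it descends to [SS].
    Together with [rten_splitW] this identifies [SS] with [sst]. *)
Lemma rten_wr_prod :
  exists j : hom SS (s · (s · t)),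
    W i1 j i1 ** W i1 q i1 = W (s · s) μ i1 ** W s ψ t.
Proof.
have [h hh] : exists h : hom (s · t · (s · t)) (s · (s · t)),
    pk h = W (s · s) μ i1 ** W s ψ t.
  by exists ⟨(Id s ⊙ Id s ⊙ μ) ∙ (Id s ⊙ ψ ⊙ Id t)⟩; rewrite -[LHS]W1; wn.
have [|j /meq_pk hj] := rten_desc (R := R) Q (r := ra) (l := la) (h := h).
  rewrite wr_ractW wr_lactW hh; s1; rewrite -!acompA.
  use (Wx s i1 ψ μ i1).
  use (esym (wr_mulAW (s · s) i1)).
  by use (wr_psi_mulW s t).
by exists j; rewrite -hh -hj pk_vcomp !W1.
Qed.

(** The section is [j] followed by [s ⊙ η ⊙ st]. By [rten_splitW] the composite [q c q] is [q], and
    [q] is epi. *)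
Lemma rten_section : exists c : hom SS (s · t · (s · t)), q ∙ c ≡ Id SS.
Proof.
have [j hj] := rten_wr_prod.
have [c hc] : exists c : hom SS (s · t · (s · t)),
    pk c = W s η (s · t) ** W i1 j i1.
  move: j {hj}; move: SS => P j.
  by exists ⟨(Id s ⊙ η ⊙ Id (s · t)) ∙ j⟩; rewrite -[LHS]W1; wn.
exists c.
have -> : q ∙ c = Id SS; last by [].
apply: (rten_epi (R := R)); apply: pk_meq.
rewrite !pk_vcomp hc -!acompA -(W1 q) hj rten_splitW W1.
exact/esym/aidl.
Qed.

(** The cell [e1] is [e0] rebracketed, and [e] is its image in [sst]. Conditions on the actions of
    [t] become explicit through [wr_lactW] and [wr_ractW]; only the Frobenius equation has to be
    transported from [SS] to [sst]. *)
Lemma frobenius_lift_iff (θ : hom (s · t) t) (e0 : hom i1 (s · t · (s · t)))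
    (e1 : hom i1 (s · (t · (s · t)))) (e : hom i1 (s · (s · t))) :
  pk e0 = pk e1 -> e ≡ (Id s ⊙ Id s ⊙ μ) ∙ (Id s ⊙ ψ ⊙ Id t) ∙ e1 ->
  frobenius_lift (wr_extension X) Q θ e0 <->
  [/\ θ ∙ (Id s ⊙ μ) ∙ (ψ ⊙ Id t) ≡ μ ∙ (Id t ⊙ θ),
      θ ∙ (Id s ⊙ μ) ≡ μ ∙ (θ ⊙ Id t),
      W (s · s) μ i1 ** W s ψ t ** W i1 ζ (s · t) ** W (s · (s · s)) μ i1
        ** W (s · s) ψ t ** W s ψ (s · t) ** W (s · t) e i1 =
      W (s · s) μ i1 ** W s ζ t ** W (s · (s · s)) μ i1 ** W (s · s) ψ t
        ** W i1 e (s · t),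
      (Id s ⊙ μ) ∙ (Id s ⊙ Id t ⊙ θ) ∙ e1 ≡ σ
    & (Id s ⊙ μ) ∙ (ψ ⊙ Id t) ∙ (θ ⊙ Id s ⊙ Id t) ∙ e1 ≡ σ].
Proof.
move=> /pk_meq he0 he.
have e0W B C (f : hcat _ B) (g : hcat C _) : W f e0 g = W f e1 g by apply: W_meq.
have eW B C (f : hcat _ B) (g : hcat C _) : W f e g =
    W (f · (s · s)) μ g ** W (f · s) ψ (t · g) ** W f e1 g.
  by have := W_meq f g he; wn.
have c1 : θ ∙ la ≡ μ ∙ (Id t ⊙ θ) <-> θ ∙ (Id s ⊙ μ) ∙ (ψ ⊙ Id t) ≡ μ ∙ (Id t ⊙ θ).
  by apply: meq_iff => //; rewrite -[LHS]W1 -[RHS]W1 [LHS]W_vcomp wr_lactW; wn.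
have c2 : θ ∙ ra ≡ μ ∙ (θ ⊙ Id t) <-> θ ∙ (Id s ⊙ μ) ≡ μ ∙ (θ ⊙ Id t).
  by apply: meq_iff => //; rewrite -[LHS]W1 -[RHS]W1 [LHS]W_vcomp wr_ractW; wn.
have c4 : ra ∙ (Id (s · t) ⊙ θ) ∙ e0 ≡ σ <-> (Id s ⊙ μ) ∙ (Id s ⊙ Id t ⊙ θ) ∙ e1 ≡ σ.
  by apply: meq_iff => //; rewrite -[LHS]W1 -[RHS]W1 W_vcomp W_vcomp wr_ractW e0W; wn.
have c5 : la ∙ (θ ⊙ Id (s · t)) ∙ e0 ≡ σ <->
    (Id s ⊙ μ) ∙ (ψ ⊙ Id t) ∙ (θ ⊙ Id s ⊙ Id t) ∙ e1 ≡ σ.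
  by apply: meq_iff => //; rewrite -[LHS]W1 -[RHS]W1 W_vcomp W_vcomp wr_lactW e0W; wn.
have c3 : pk q ** pk (m ⊙ Id (s · t)) ** pk (Id (s · t) ⊙ e0) =
    pk q ** pk (Id (s · t) ⊙ m) ** pk (e0 ⊙ Id (s · t)) <->
  W (s · s) μ i1 ** W s ψ t ** W i1 ζ (s · t) ** W (s · (s · s)) μ i1
        ** W (s · s) ψ t ** W s ψ (s · t) ** W (s · t) e i1 =
      W (s · s) μ i1 ** W s ζ t ** W (s · (s · s)) μ i1 ** W (s · s) ψ t
        ** W i1 e (s · t).
  have kl := f_equal (fun p => p ** W (s · t) e1 i1) (rten_mul_l X).
  have kr := f_equal (fun p => p ** W i1 e1 (s · t)) (rten_mul_r X).
  rewrite -[pk q]W1 -[pk (m ⊙ _)]W1 -[pk (_ ⊙ m)]W1 -[pk (_ ⊙ e0)]W1 -[pk (e0 ⊙ _)]W1.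
  have [j hj] := rten_wr_prod; have hs := rten_splitW.
  move: (W i1 q i1) (W i1 j i1) hj hs => a b hj hs.
  rewrite !W_l !W_r !e0W !eW; move: kl kr; s1; rewrite -!acompA => kl kr.
  rewrite (comp1AV s t (s · s)) (comp1AV s t s) -kl -kr.
  (* In one direction [hj] factors both sides through [q]. In the other, [hs] factors [q] through
     the map to [sst]. *)
  split=> [h|h].
    by rewrite !(tail2 (esym hj)) -!acompA h.
  by rewrite -hs -!acompA h.
rewrite /frobenius_lift /ext_bimodule_hom.
split=> [[[/c1 h1 /c2 h2] /meq_pk h3 /c4 h4 /c5 h5]|[/c1 h1 /c2 h2 /c3 h3 /c4 h4 /c5 h5]].
  by rewrite !pk_vcomp -!acompA in h3; split=> //; apply/c3.
by split=> //; apply: pk_meq; rewrite !pk_vcomp -!acompA.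
Qed.

Lemma frobenius_lift_cells :
  (exists theta e, frobenius_lift (wr_extension X) Q theta e) ->
  exists ϑ e, frobenius_cells (X := X) ϑ e.
Proof.
move=> [θ [e0]].
change (hom (s · t) t) in (type of θ).
change (hom i1 (s · t · (s · t))) in (type of e0).
have [e1 he1] : exists e1 : hom i1 (s · (t · (s · t))), pk e0 = pk e1.
  by exists ⟨e0⟩; rewrite -[LHS]W1 -[RHS]W1 W_cast.
have [e he] : exists e : hom i1 (s · (s · t)),
    e ≡ (Id s ⊙ Id s ⊙ μ) ∙ (Id s ⊙ ψ ⊙ Id t) ∙ e1.
  by exists ⟨(Id s ⊙ Id s ⊙ μ) ∙ (Id s ⊙ ψ ⊙ Id t) ∙ e1⟩; wstart.
case/(frobenius_lift_iff θ he1 he)=> hl hr /(@wr_prod_centralP _ X) [hE hF] h1 h2.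
have θlW B C (f : hcat _ B) (g : hcat C _) :
    W f θ g ** W (f · s) μ g ** W f ψ (t · g) = W f μ g ** W (f · t) θ g.
  by have := W_meq f g hl; wn.
have θrW B C (f : hcat _ B) (g : hcat C _) :
    W f θ g ** W (f · s) μ g = W f μ g ** W f θ (t · g).
  by have := W_meq f g hr; wn.
have eW B C (f : hcat _ B) (g : hcat C _) : W f e g =
    W (f · (s · s)) μ g ** W (f · s) ψ (t · g) ** W f e1 g.
  by have := W_meq f g he; wn.
have [ϑ ϑW] : exists ϑ : hom s t, forall B C (f : hcat _ B) (g : hcat C _),
    W f ϑ g = W f θ g ** W (f · s) η g.
  by exists ⟨θ ∙ (Id s ⊙ η)⟩ => B C f g; wn.
(* Right [t]-linearity recovers [θ] from its restriction [ϑ] along [s ⊙ η]. *)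
have θE B C (f : hcat _ B) (g : hcat C _) :
    W f μ g ** W f ϑ (t · g) = W f θ g.
  rewrite ϑW; use (esym (θrW _ _ f g)).
  use (mmul1mW (T := wr_base X) (f · s) g).
  by unit_rules.
exists ϑ, e; split=> //.
- wstart.
  use (θE _ _ i1 i1).
  rewrite !ϑW; s1; rewrite -?acompA.
  use (esym (θlW _ _ i1 i1)).
  use (Wx i1 i1 ψ η i1).
  use (mmulm1W (T := wr_base X) s i1).
  by unit_rules.
- have := W_meq i1 i1 h2; wn => {}h2.
  wstart; use (eW _ _ i1 i1).
  use (Wx i1 s ϑ μ i1).
  use (Wx i1 i1 ψ μ i1).
  use (esym (wr_mulAW s i1)).
  use (Wx i1 i1 ϑ ψ t).
  use (wr_psi_mulW i1 t).
  use (θE _ _ i1 (s · t)).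
  by use h2.
- have := W_meq i1 i1 h1; wn => {}h1.
  wstart; use (eW _ _ i1 i1).
  use (θE _ _ s i1).
  use (θlW _ _ s i1).
  by use h1.
Qed.

Lemma frobenius_cells_lift :
  (exists ϑ e, frobenius_cells (X := X) ϑ e) ->
  exists theta e, frobenius_lift (wr_extension X) Q theta e.
Proof.
move=> [ϑ [e [hT hE hF h1 h2]]].
have ϑW B C (f : hcat _ B) (g : hcat C _) :
    W f μ g ** W f ϑ (t · g) ** W f ψ g = W f μ g ** W (f · t) ϑ g.
  by have := W_meq f g hT; wn.
have [θ θE] : exists θ : hom (s · t) t, forall B C (f : hcat _ B) (g : hcat C _),
    W f θ g = W f μ g ** W f ϑ (t · g).
  by exists (μ ∙ (ϑ ⊙ Id t)) => B C f g; wn.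
(* Inserting [η] after the first [s] is a section of the map from [stst] to [sst], by
   [wr_psi_unitW]; so [e1] represents [e]. *)
have [e1 e1W] : exists e1 : hom i1 (s · (t · (s · t))),
    forall B C (f : hcat _ B) (g : hcat C _),
    W f e1 g = W (f · s) η (s · (t · g)) ** W f e g.
  by exists ⟨(Id s ⊙ η ⊙ Id (s · t)) ∙ e⟩ => B C f g; wn.
have [e0 he0] : exists e0 : hom i1 (s · t · (s · t)), pk e0 = pk e1.
  by exists ⟨e1⟩; rewrite -[LHS]W1 -[RHS]W1 W_cast.
have he : e ≡ (Id s ⊙ Id s ⊙ μ) ∙ (Id s ⊙ ψ ⊙ Id t) ∙ e1.
  wstart; use (e1W _ _ i1 i1).
  use (wr_psi_unitW s t).
  use (mmul1mW (T := wr_base X) (s · s) i1).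
  by unit_rules.
exists θ, e0; apply/(frobenius_lift_iff θ he0 he); split.
- wstart; rewrite !θE; s1; rewrite -?acompA.
  use (Wx i1 i1 ϑ μ i1).
  use (esym (wr_mulAW (X := X) i1 i1)).
  use (ϑW _ _ i1 t).
  by use (wr_mulAW (X := X) i1 i1).
- wstart; rewrite !θE; s1; rewrite -?acompA.
  use (Wx i1 i1 ϑ μ i1).
  by use (esym (wr_mulAW (X := X) i1 i1)).
- by apply/wr_prod_centralP.
- have := W_meq i1 i1 h2; wn => {}h2.
  wstart; rewrite !θE; s1; rewrite -?acompA; use (e1W _ _ i1 i1).
  use (esym (wr_mulAW s i1)).
  use (esym (Wx s i1 η ϑ t)).
  use (mmul1mW (T := wr_base X) s t).
  unit_rules; by use h2.
- have := W_meq i1 i1 h1; wn => {}h1.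
  wstart; rewrite !θE; s1; rewrite -?acompA; use (e1W _ _ i1 i1).
  use (Wx i1 i1 ϑ η (s · t)).
  use (mmulm1W (T := wr_base X) i1 (s · t)).
  unit_rules; by use h1.
Qed.

End WreathLift.

Theorem theorem6p6 (K : twocat) (X : wreath K) :
  let M := EM_moncat (wr_base X) in
  let S : M := wr_em1 X in
  let t := wr_t X in
  let μ := wr_mu X in
  let s := wr_s X in
  let ψ := wr_psi X in
  let ζ := wr_zeta X in
  let i := frobenius_monad X in
  let ii := frobenius_algebra (wr_algebra X) in
  let iii := exists C : coalgebra_on S,
    let δ : hom s (s · s · t) := em_cell (comul C) in
    (Id s ⊙ Id s ⊙ μ) ∙ (δ ⊙ Id t) ∙ ζ
      ≡ (Id s ⊙ Id s ⊙ μ) ∙ (Id s ⊙ ζ ⊙ Id t) ∙ (Id s ⊙ Id s ⊙ ψ)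
          ∙ (δ ⊙ Id s) /\
    (Id s ⊙ Id s ⊙ μ) ∙ (Id s ⊙ ζ ⊙ Id t) ∙ (Id s ⊙ Id s ⊙ ψ) ∙ (δ ⊙ Id s)
      ≡ (Id s ⊙ Id s ⊙ μ) ∙ (Id s ⊙ ψ ⊙ Id t) ∙ (ζ ⊙ Id s ⊙ Id t)
          ∙ (Id s ⊙ δ) in
  let iv := exists (rho : hom (tunit (m := M)) (S ⊗ S))
      (lambda : hom (S ⊗ S) (tunit (m := M))),
    adjunction rho lambda /\
    let λ : hom (s · s) (id1 (wr_cell0 X) · t) := em_cell lambda in
    μ ∙ (λ ⊙ Id t) ∙ (Id s ⊙ ψ) ∙ (ζ ⊙ Id s) ≡ μ ∙ (λ ⊙ Id t) ∙ (Id s ⊙ ζ) in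
  let v := exists (rho : hom (tunit (m := M)) (S ⊗ S))
      (lambda : hom (S ⊗ S) (tunit (m := M))),
    adjunction rho lambda /\
    exists ϑ : hom s t, em_cell lambda ≡ μ ∙ (ϑ ⊙ Id t) ∙ ζ in
  (i <-> ii) /\ (ii <-> iii) /\ (iii <-> iv) /\ (iv <-> v) /\
  (forall Q : coequalizers (hom_moncat (wr_cell0 X)),
    (forall Y : hom_moncat (wr_cell0 X), coflat Y) ->
    (i <-> frobenius_extension Q (wr_extension X))).
Proof.
move=> M S t μ s ψ ζ i ii iii iv v.
have i_ii : i <-> ii := frobenius_rev_algebra X.
(* The cycle (i), (iii), (iv), (v), (i) consists of the statements for monads, applied in [EM K],
   each combined with a translation into 2-cells of [K]. *)
have i_iii : i -> iii.
  case/frobenius_bilinear_coalgebra => C h; exists C.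
  exact/bilinear_cells.
have iii_iv : iii -> iv.
  case=> C h; have [hl hr] := proj2 (bilinear_cells (comul C)) h.
  have [rho [lambda [adj hA]]] := associative_self_adjunction hl hr.
  by exists rho, lambda; split=> //; apply/associative_cells.
have iv_v : iv -> v.
  case=> rho [lambda [adj h]]; have hA := proj2 (associative_cells lambda) h.
  exists rho, lambda; split=> //; apply/form_cells.
  exact: associative_adjunction_form.
have v_i : v -> i.
  case=> rho [lambda [adj h]]; have [theta hl] := proj2 (form_cells lambda) h.
  exact: frobenius_of_self_adjunction adj hl.
split; first exact: i_ii.
split.
  split=> h; first exact: i_iii (proj2 i_ii h).
  exact: proj1 i_ii (v_i (iv_v (iii_iv h))).
split; first by split=> // h; exact: i_iii (v_i (iv_v h)).
split; first by split=> // h; exact: iii_iv (i_iii (v_i h)).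
(* Both directions pass through [frobenius_cells] and [frobenius_lift]. Coflatness builds the maps
   on [st ⊗_t st] in the first; the section of [q] gives the representative in the second. *)
move=> Q fl; split.
  move/frobenius_monad_cells/(frobenius_cells_lift Q) => [theta [e h]].
  exact: frobenius_extension_lift h.
have [c hc] := rten_section Q.
move/(frobenius_extension_section (i := wr_extension X) hc)/frobenius_lift_cells.
by move/frobenius_monad_cells.
Qed.
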